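(* There exist universal constants $C>0$ and $C'>0$ such that the following holds for all $n\ge 2$ and $\epsilon,\delta\in(0,1)$. Let $m\ge C\cdot\frac{1}{\epsilon^2}\left(\sqrt{n\log(1/\delta)}+\log(1/\delta)\right)$. Consider the algorithm that draws $m$ i.i.d. samples from an unknown distribution $p$ on $[n]$, lets $X_i$ be the number of samples equal to $i$, computes $S=\frac12\sum_{i=1}^n\left|\frac{X_i}{m}-\frac1n\right|$, and outputs ''NO'' if $S\ge t$ and ''YES'' otherwise, where $$t=\mu(U_n)+C'\cdot\begin{cases}\epsilon^2\frac{m^2}{n^2} & m\le n,\\ \epsilon^2\sqrt{m/n} & n<m\le n/\epsilon^2,\\ \epsilon & n/\epsilon^2\le m,\end{cases}$$ and $\mu(U_n)$ is the expected value of $S$ when the samples are drawn from the uniform distribution $U_n$. Then with probability at least $1-\delta$ the algorithm outputs ''YES'' if $p=U_n$ and outputs ''NO'' if $d_{\mathrm{TV}}(p,U_n)\ge\epsilon$.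
   Context: $d_{\mathrm{TV}}(p,q)=\frac12\sum_i|p_i-q_i|$ for distributions on $[n]$; $U_n$ is the uniform distribution on $[n]$.
   Formalization: In the bound on m, log(1/δ) is read as max(1, ln(1/δ)); with the bare logarithm the claim fails as δ tends to 1 (n=2, ε=1/2, m=1: S is constantly 1/2, so the answer is always YES). The two agree for δ ≤ 1/e. *)

(* Defs.v *)
From HB Require Import structures.
From mathcomp Require Import all_boot all_order all_algebra.
From mathcomp Require Import reals exp.

Set Implicit Arguments.
Unset Strict Implicit.
Unset Printing Implicit Defensive.

Import Order.TTheory GRing.Theory Num.Theory.
Local Open Scope ring_scope.

Definition is_distr (R : realType) (n : nat) (p : {ffun 'I_n -> R}) : Prop :=
  (forall i, 0 <= p i) /\ \sum_i p i = 1.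

Definition uniform (R : realType) (n : nat) : {ffun 'I_n -> R} :=
  [ffun _ => n%:R^-1].

Definition dTV (R : realType) (n : nat) (p q : {ffun 'I_n -> R}) : R :=
  2^-1 * \sum_i `|p i - q i|.

Definition sample (n m : nat) := {ffun 'I_m -> 'I_n}.

Definition iid_weight (R : realType) (n m : nat) (p : {ffun 'I_n -> R})
    (x : sample n m) : R :=
  \prod_(j < m) p (x j).

Definition Pr_iid (R : realType) (n m : nat) (p : {ffun 'I_n -> R})
    (A : pred (sample n m)) : R :=
  \sum_(x : sample n m | A x) iid_weight p x.

Definition E_iid (R : realType) (n m : nat) (p : {ffun 'I_n -> R})
    (f : sample n m -> R) : R :=
  \sum_(x : sample n m) iid_weight p x * f x.

Definition occ (n m : nat) (x : sample n m) (i : 'I_n) : nat :=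
  #|[set j : 'I_m | x j == i]|.

Definition tv_stat (R : realType) (n m : nat) (x : sample n m) : R :=
  2^-1 * \sum_(i < n) `|(occ x i)%:R / m%:R - n%:R^-1|.

Definition mu (R : realType) (n m : nat) (p : {ffun 'I_n -> R}) : R :=
  E_iid p (fun x : sample n m => tv_stat R x).

Definition gap (R : realType) (n m : nat) (eps : R) : R :=
  if (m <= n)%N then eps ^+ 2 * (m%:R ^+ 2 / n%:R ^+ 2)
  else if m%:R <= n%:R / eps ^+ 2 then eps ^+ 2 * Num.sqrt (m%:R / n%:R)
  else eps.

Definition threshold (R : realType) (n m : nat) (C' eps : R) : R :=
  mu m (uniform R n) + C' * gap n m eps.

Inductive verdict := YES | NO.

Definition is_YES (v : verdict) : bool := if v is YES then true else false.
Definition is_NO (v : verdict) : bool := if v is NO then true else false.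

Definition tester (R : realType) (n m : nat) (C' eps : R) (x : sample n m)
    : verdict :=
  if threshold n m C' eps <= tv_stat R x then NO else YES.

(* log (1 / delta) with the usual convention that it is at least 1.  With a
   bare logarithm the sample bound below would admit m = 1 as delta tends to 1,
   and tv_stat is then constant, so the tester could never answer NO.  The two
   agree for delta <= 1 / e. *)
Definition log_inv (R : realType) (delta : R) : R :=
  Num.max 1 (ln (1 / delta)).

Definition sample_bound (R : realType) (n : nat) (eps delta : R) : R :=
  1 / eps ^+ 2 * (Num.sqrt (n%:R * log_inv delta) + log_inv delta).

(* Main.v *)
(* In terms of kappa = m/n and h(a) = |a - kappa|, the statistic is
   S = (1/2m) sum_i h(X_i), so E S = (1/2m) sum_i f(p_i), where f(x) is the mean
   of h under Bin(m, x): a Bernstein polynomial of the convex function h.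

   Soundness.  Moving mass from a cell to a cell that is at most as heavy makes S
   stochastically smaller.  Averaging p over a set T of floor(n/2) cells which
   carries an excess of at least eps/3, then over its complement, and finally
   shrinking the excess, we may replace p by a distribution q with two levels,
   all within a factor 1 +- eps/2 of 1/n.  For such q a second-order Taylor
   expansion of f at 1/n gives E_q S - E_U S >= c * gap, as f'' is m(m-1) times
   the mean of the second difference of h under Bin(m-2, x), and this second
   difference lives next to kappa, where the binomial mass is at least of order
   1/sqrt(kappa + 1).  When m > n/eps^2, Jensen's inequality
   E_p S >= d_TV(p, U) together with E_U S <= eps/2 is enough.

   Concentration.  For m > n, use bounded differences 1/m.  For m <= n, S is the
   number of empty cells divided by n; when all p_i <= 2/n the increments of its
   Doob martingale are in a unit interval and have conditional variance at most
   2m/n, which gives a Bernstein bound with total variance of order m^2/n. *)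
Require Import Defs.
From HB Require Import structures.
From mathcomp Require Import all_boot all_order all_algebra all_fingroup.
From mathcomp Require Import reals topology normedtype sequences derive realfun exp.
From mathcomp Require Import polyrcf ring lra.
Import Order.TTheory GRing.Theory Num.Theory.
Import numFieldNormedType.Exports.
Local Open Scope ring_scope.

Set Implicit Arguments.
Unset Strict Implicit.
Unset Printing Implicit Defensive.

(** * Expectation over i.i.d. samples and bounded differences *)

(** All cases rest on [exp y <= 1 / (1 - y)] for [y < 1], the reciprocal of [1 - y <= exp (- y)]. *)
Lemma expR_le_quadratic (R : realType) (x : R) :
  `|x| <= 1 -> expR x <= 1 + x + 2 * x ^+ 2.
Proof.
rewrite ler_norml => /andP[x1 x2].
have inv_le (y : R) : y < 1 -> expR y <= (1 - y)^-1.
  move=> y1; rewrite -[expR y]invrK -expRN lef_pV2 ?posrE ?expR_gt0 ?subr_gt0 //.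
  exact: expR_ge1Dx.
have [x0|x0] := leP x 0.
  apply: le_trans (inv_le x _) _; first by lra.
  rewrite -[leLHS]mul1r ler_pdivrMr; last by lra.
  by nra.
(* The bound [1 / (1 - x)] blows up at 1, so it is applied to [x / 2] and squared; at [x = 1] both
   sides become 4. *)
have -> : x = x / 2 + x / 2 by lra.
rewrite expRD; apply: (@le_trans _ _ ((1 - x / 2)^-1 * (1 - x / 2)^-1)).
  by apply: ler_pM; rewrite ?expR_ge0 ?inv_le //; lra.
rewrite -invfM -[leLHS]mul1r ler_pdivrMr; last by nra.
rewrite -subr_ge0.
have -> : (1 + (x / 2 + x / 2) + 2 * (x / 2 + x / 2) ^+ 2)
    * ((1 - x / 2) * (1 - x / 2)) - 1 = x ^+ 2 / 4 * ((1 - x) * (5 - 2 * x)).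
  by field.
by apply: mulr_ge0; [rewrite divr_ge0 ?sqr_ge0 | apply: mulr_ge0; lra].
Qed.

(** The i.i.d. expectation with the first draw peeled off, so that conditioning on that draw is a
    computation and inductions on [m] follow the martingale. *)
Fixpoint Eseq (R : realType) n (p : {ffun 'I_n -> R}) m (f : seq 'I_n -> R) : R :=
  if m is m'.+1 then \sum_i p i * Eseq p m' (fun s => f (i :: s)) else f [::].

Definition cons_sample n m (i : 'I_n) (y : sample n m) : sample n m.+1 :=
  [ffun j => oapp y i (unlift ord0 j)].

Lemma cons_sample0 n m (i : 'I_n) (y : sample n m) : cons_sample i y ord0 = i.
Proof. by rewrite ffunE unlift_none. Qed.

Lemma cons_sampleS n m (i : 'I_n) (y : sample n m) j :
  cons_sample i y (lift ord0 j) = y j.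
Proof. by rewrite ffunE liftK. Qed.

Lemma codom_cons_sample n m (i : 'I_n) (y : sample n m) :
  codom (cons_sample i y) = i :: codom y.
Proof.
rewrite /codom /image_mem enum_ordSl /= cons_sample0 -map_comp; congr cons.
by apply: eq_map => j /=; rewrite cons_sampleS.
Qed.

Lemma E_iid_Eseq (R : realType) n m (p : {ffun 'I_n -> R}) (f : seq 'I_n -> R) :
  E_iid p (fun x : sample n m => f (codom x)) = Eseq p m f.
Proof.
elim: m f => [|m IHm] f /=.
  rewrite /E_iid (big_pred1 (ffun0 (card_ord 0))).
    rewrite /iid_weight big_ord0 mul1r; congr f.
    by apply: size0nil; rewrite size_codom card_ord.
  by move=> x; apply/esym/eqP/ffunP => -[].
under eq_bigr => i _ do rewrite -IHm mulr_sumr.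
rewrite pair_big /= /E_iid.
rewrite (reindex (fun u : 'I_n * sample n m => cons_sample u.1 u.2)) /=.
  apply: eq_bigr => -[i y] _ /=.
  rewrite codom_cons_sample mulrA; congr (_ * _).
  rewrite /iid_weight big_ord_recl cons_sample0; congr (_ * _).
  by apply: eq_bigr => j _; rewrite cons_sampleS.
exists (fun x : sample n m.+1 => (x ord0, [ffun j => x (lift ord0 j)])).
  move=> [i y] _ /=; rewrite cons_sample0; congr pair.
  by apply/ffunP => j; rewrite ffunE cons_sampleS.
move=> x _; apply/ffunP => j; rewrite ffunE /=.
by case: unliftP => [k ->|->] //=; rewrite ffunE.
Qed.

Lemma count_codom n m (x : sample n m) i : count_mem i (codom x) = occ x i.
Proof.
rewrite /occ /codom /image_mem count_map -sum1_card big_mkcond -sum1_count /=.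
by rewrite big_enum_cond /= big_mkcond /=; apply: eq_bigr => j _; rewrite inE.
Qed.

Definition tv_seq (R : realType) n m (s : seq 'I_n) : R :=
  2^-1 * \sum_i `|(count_mem i s)%:R / m%:R - n%:R^-1|.

Lemma tv_stat_codom (R : realType) n m (x : sample n m) :
  tv_stat R x = tv_seq R m (codom x).
Proof. by congr (_ * _); apply: eq_bigr => i _; rewrite count_codom. Qed.

Section Expectation.
Variables (R : realType) (n : nat) (p : {ffun 'I_n -> R}).
Implicit Types (f g : seq 'I_n -> R) (m : nat).

Lemma eq_Eseq m f g : f =1 g -> Eseq p m f = Eseq p m g.
Proof.
elim: m f g => [|m IHm] f g fg /=; first exact: fg.
by apply: eq_bigr => i _; congr (_ * _); apply: IHm => s; apply: fg.
Qed.

Lemma EseqD m f g : Eseq p m (fun s => f s + g s) = Eseq p m f + Eseq p m g.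
Proof.
elim: m f g => [|m IHm] f g //=.
by rewrite -big_split /=; apply: eq_bigr => i _; rewrite IHm mulrDr.
Qed.

Lemma EseqZ m c f : Eseq p m (fun s => c * f s) = c * Eseq p m f.
Proof.
elim: m f => [|m IHm] f //=.
by rewrite mulr_sumr; apply: eq_bigr => i _; rewrite IHm mulrCA.
Qed.

Lemma Eseq_sum m (I : finType) (F : I -> seq 'I_n -> R) :
  Eseq p m (fun s => \sum_k F k s) = \sum_k Eseq p m (F k).
Proof.
elim: m F => [|m IHm] F //=.
rewrite exchange_big /=; apply: eq_bigr => i _.
by rewrite IHm mulr_sumr.
Qed.

Hypothesis p_distr : is_distr p.

Lemma Eseq_cst m c : Eseq p m (fun=> c) = c.
Proof.
by elim: m => [//|m IHm] /=; rewrite IHm -mulr_suml p_distr.2 mul1r.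
Qed.

Lemma ler_Eseq m f g : (forall s, size s = m -> f s <= g s) ->
  Eseq p m f <= Eseq p m g.
Proof.
elim: m f g => [|m IHm] f g fg /=; first exact: fg.
apply: ler_sum => i _; apply: ler_wpM2l; first exact: p_distr.1.
by apply: IHm => s sz; apply: fg; rewrite /= sz.
Qed.

(** McDiarmid's argument: given the first draw [i], the conditional mean [a i] is within [c] of the
    full mean [A]. In the quadratic bound for [expR (l * (a i - A))] the linear term averages to 0,
    and the later draws are handled by induction. The factor 2 is that of [expR_le_quadratic]. *)
Lemma mgf_bounded_differences m f l c :
    0 <= c -> `|l| * c <= 1 ->
    (forall i j s1 s2, (size s1 + size s2).+1 = m ->
      f (s1 ++ i :: s2) - f (s1 ++ j :: s2) <= c) ->
  Eseq p m (fun s => expR (l * (f s - Eseq p m f)))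
    <= expR (2 * (l * c) ^+ 2 * m%:R).
Proof.
move=> c0 lc.
have Ele k g1 g2 : (forall s, size s = k -> g1 s - g2 s <= c) ->
    Eseq p k g1 - Eseq p k g2 <= c.
  move=> h; rewrite -mulN1r -EseqZ -EseqD -[leRHS](Eseq_cst k).
  by apply: ler_Eseq => s sz; rewrite mulN1r h.
elim: m f => [|m IHm] f hf /=.
  by rewrite subrr !mulr0.
set a := fun i => Eseq p m (fun s => f (i :: s)).
set A := \sum_i p i * a i.
have step i : Eseq p m (fun s => expR (l * (f (i :: s) - A)))
    <= expR (l * (a i - A)) * expR (2 * (l * c) ^+ 2 * m%:R).
  rewrite (eq_Eseq _ (g := fun s =>
    expR (l * (a i - A)) * expR (l * (f (i :: s) - a i)))); last first.
    by move=> s; rewrite -expRD -mulrDr [a i - A + _]addrC subrKA.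
  rewrite EseqZ ler_wpM2l ?expR_ge0 //; apply: IHm => k j s1 s2 sz.
  by apply: (hf k j (i :: s1)); rewrite /= addSn sz.
have aA i : `|a i - A| <= c.
  have E j : a j - a i <= c /\ a i - a j <= c.
    by split; apply: Ele => s sz; apply: (hf _ _ [::]); rewrite /= add0n sz.
  have Ai : a i = \sum_j p j * a i by rewrite -mulr_suml p_distr.2 mul1r.
  have cE : c = \sum_j p j * c by rewrite -mulr_suml p_distr.2 mul1r.
  rewrite ler_norml; apply/andP; split.
    rewrite lerNl opprB cE Ai -sumrB; apply: ler_sum => j _.
    by rewrite -mulrBr ler_wpM2l ?p_distr.1 // (E j).1.
  rewrite cE Ai -sumrB; apply: ler_sum => j _.
  by rewrite -mulrBr ler_wpM2l ?p_distr.1 // (E j).2.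
apply: (@le_trans _ _ (\sum_i p i *
    (1 + l * (a i - A) + 2 * (l * c) ^+ 2) * expR (2 * (l * c) ^+ 2 * m%:R))).
  apply: ler_sum => i _; rewrite -mulrA ler_wpM2l ?p_distr.1 //.
  apply: le_trans (step i) _; rewrite ler_wpM2r ?expR_ge0 //.
  apply: le_trans (expR_le_quadratic _) _.
    by rewrite normrM (le_trans _ lc) // ler_wpM2l.
  rewrite lerD2l ler_wpM2l // !exprMn ler_wpM2l ?sqr_ge0 //.
  by rewrite -(real_normK (num_real (a i - A))) lerXn2r ?nnegrE.
have -> : \sum_i p i * (1 + l * (a i - A) + 2 * (l * c) ^+ 2)
    * expR (2 * (l * c) ^+ 2 * m%:R)
    = (1 + 2 * (l * c) ^+ 2) * expR (2 * (l * c) ^+ 2 * m%:R).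
  rewrite -mulr_suml; congr (_ * _).
  rewrite (eq_bigr (fun i => p i * (1 - l * A + 2 * (l * c) ^+ 2)
    + l * (p i * a i))); last by move=> i _; ring.
  by rewrite big_split /= -mulr_suml -mulr_sumr -/A p_distr.2; ring.
rewrite -[m.+1%:R]natr1 mulrDr mulr1 expRD [leRHS]mulrC ler_wpM2r ?expR_ge0 //.
exact: expR_ge1Dx.
Qed.

End Expectation.

(** * Number of empty cells and its Doob martingale *)

Definition unseen (R : realType) n (s : seq 'I_n) : R :=
  \sum_(l < n) (l \notin s)%:R.

(** The conditional mean of the number of empty cells when [A] has been drawn and [r] draws remain;
    see [Eseq_unseen]. *)
Definition mean_unseen (R : realType) n (p : {ffun 'I_n -> R}) (A : seq 'I_n) r : R :=
  \sum_(l < n | l \notin A) (1 - p l) ^+ r.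

Section Unseen.
Variables (R : realType) (n : nat) (p : {ffun 'I_n -> R}).
Hypothesis p_distr : is_distr p.
Implicit Types (A : seq 'I_n).

Lemma distr_le1 i : p i <= 1.
Proof.
rewrite -p_distr.2 (bigD1 i) //= lerDl; apply: sumr_ge0 => j _.
exact: p_distr.1.
Qed.

Lemma sum_distrC i : \sum_(j | j != i) p j = 1 - p i.
Proof. by rewrite -p_distr.2 [in RHS](bigD1 i) //= addrC addrK. Qed.

Lemma unseen_cat_cons A i s : unseen R (A ++ i :: s) = unseen R ((i :: A) ++ s).
Proof.
by apply: eq_bigr => l _; rewrite cat_cons !(in_cons, mem_cat) orbCA.
Qed.

Lemma mean_unseen_cons A i r :
  mean_unseen p (i :: A) r
    = mean_unseen p A r - 1 + (if i \in A then 1 else 1 - (1 - p i) ^+ r).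
Proof.
rewrite /mean_unseen; case: ifP => [iA|/negbT iA].
  rewrite subrK; apply: eq_bigl => l; rewrite in_cons.
  by case: eqP => [->|//]; rewrite iA.
rewrite [in RHS](bigD1 i) //= (eq_bigl (fun l => (l \notin A) && (l != i))).
  by ring.
by move=> l; rewrite in_cons negb_or andbC.
Qed.

(** The martingale property: a cell [l] outside [A] survives the next draw with probability
    [1 - p l], which is the extra factor. *)
Lemma mean_unseenS A r :
  mean_unseen p A r.+1 = \sum_i p i * mean_unseen p (i :: A) r.
Proof.
transitivity (\sum_i \sum_(l < n | l \notin A)
    (if l != i then p i else 0) * (1 - p l) ^+ r).
  rewrite exchange_big /mean_unseen; apply: eq_bigr => l _.
  rewrite -mulr_suml exprS; congr (_ * _).
  rewrite -sum_distrC [in RHS]big_mkcond [in LHS]big_mkcond /=.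
  by apply: eq_bigr => i _; rewrite eq_sym.
apply: eq_bigr => i _; rewrite /mean_unseen mulr_sumr.
rewrite [in RHS]big_mkcond [in LHS]big_mkcond /=.
apply: eq_bigr => l _; rewrite in_cons negb_or.
by case: (l \in A); case: (l == i) => //=; rewrite mul0r.
Qed.

Lemma Eseq_unseen A r :
  Eseq p r (fun s => unseen R (A ++ s)) = mean_unseen p A r.
Proof.
elim: r A => [|r IHr] A /=.
  by rewrite cats0 /mean_unseen big_mkcond /=; apply: eq_bigr => l _; case: ifP.
rewrite mean_unseenS; apply: eq_bigr => i _; congr (_ * _).
rewrite -IHr; apply: eq_Eseq => s; exact: unseen_cat_cons.
Qed.

(* A lists the cells seen so far.  Seeing i next changes the conditional mean
   [mean_unseen p A r] by W i - 1 with W i in [0, 1], and W i has mean at most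
   B * (size A + r), as cell i was seen or will be seen later. *)
Lemma mgf_unseen B l A r :
    0 <= B -> (forall i, p i <= B) -> `|l| <= 1 ->
  Eseq p r (fun s => expR (l * unseen R (A ++ s)))
    <= expR (l * mean_unseen p A r + 2 * l ^+ 2 * r%:R * (B * (size A + r)%:R)).
Proof.
move=> B0 pB l1; elim: r A => [|r IHr] A /=.
  by rewrite mulr0 mul0r addr0 -[mean_unseen _ _ _]Eseq_unseen.
set N := (size A + r.+1)%N.
pose W i := if i \in A then 1 else 1 - (1 - p i) ^+ r.
have q01 i : 0 <= 1 - p i <= 1.
  by rewrite subr_ge0 distr_le1 lerBlDr lerDl p_distr.1.
have W01 i : 0 <= W i <= 1.
  rewrite /W; case: ifP => _; first by rewrite ler01 lexx.
  case/andP: (q01 i) => q0 q1.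
  by rewrite subr_ge0 exprn_ile1 // lerBlDr lerDl exprn_ge0.
set w := \sum_i p i * W i.
have wle : w <= B * N%:R.
  apply: (@le_trans _ _ (\sum_i (B * (i \in A)%:R + p i * (r%:R * B)))).
    apply: ler_sum => i _; rewrite /W; case: ifP => iA.
      rewrite !mulr1 ler_wpDr ?pB // mulr_ge0 ?p_distr.1 //.
      by rewrite mulr_ge0 ?ler0n.
    rewrite mulr0 add0r ler_wpM2l ?p_distr.1 //.
    (* Bernoulli's inequality, giving [W i <= r * p i <= r * B] for a cell not yet seen. *)
    have : 1 - p i *+ r <= (1 - p i) ^+ r.
      case/andP: (q01 i) => q0 _.
      elim: (r) => [|k IHk]; first by rewrite mulr0n subr0.
      rewrite exprS mulrS; have := p_distr.1 i.
      have : 0 <= p i *+ k by rewrite mulrn_wge0 // p_distr.1.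
      have : (1 - p i) * (1 - p i *+ k) <= (1 - p i) * (1 - p i) ^+ k.
        by rewrite ler_wpM2l.
      by nra.
    have : p i *+ r <= r%:R * B by rewrite -[p i *+ r]mulr_natl ler_wpM2l ?ler0n.
    lra.
  rewrite big_split /= -mulr_sumr -mulr_suml p_distr.2 mul1r.
  have -> : N%:R = (size A)%:R + r%:R + 1 :> R.
    by rewrite /N addnS -natr1 natrD.
  have : \sum_(i < n) (i \in A)%:R <= (size A)%:R :> R.
    rewrite -natr_sum ler_nat (eq_bigr (fun i => if i \in A then 1%N else 0%N)).
      rewrite -big_mkcond sum1_card; exact: card_size.
    by move=> i _; case: ifP.
  move=> /(ler_wpM2l B0); lra.
have mS : mean_unseen p A r.+1 = mean_unseen p A r - 1 + w.
  rewrite mean_unseenS; under eq_bigr do rewrite mean_unseen_cons mulrDr.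
  by rewrite big_split /= -mulr_suml p_distr.2 mul1r.
set K := expR (l * (mean_unseen p A r - 1) + 2 * l ^+ 2 * r%:R * (B * N%:R)).
(* As [W i] lies in [0, 1], its square is at most [W i]; the quadratic term is then controlled by
   the mean [w], which is where Bernstein gains over bounded differences. *)
apply: (@le_trans _ _ (\sum_i p i * ((1 + l * W i + 2 * (l ^+ 2 * W i)) * K))).
  apply: ler_sum => i _; rewrite ler_wpM2l ?p_distr.1 //.
  rewrite (eq_Eseq _ _ (g := fun s => expR (l * unseen R ((i :: A) ++ s)))).
    apply: le_trans (IHr _) _.
    rewrite mean_unseen_cons -/(W i) [size _]/= addSnnS -/N.
    rewrite mulrDr -addrA addrCA expRD ler_wpM2r ?expR_ge0 //.
    case/andP: (W01 i) => W0 W1.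
    apply: le_trans (expR_le_quadratic _) _.
      rewrite normrM (ger0_norm W0); apply: le_trans l1.
      by rewrite -[leRHS]mulr1 ler_wpM2l.
    rewrite lerD2l ler_wpM2l // exprMn ler_wpM2l ?sqr_ge0 //.
    by rewrite expr2 -[leRHS]mulr1 ler_wpM2l.
  by move=> s; rewrite unseen_cat_cons.
rewrite (eq_bigr (fun i => (p i + (l + 2 * l ^+ 2) * (p i * W i)) * K));
  last by move=> i _; ring.
rewrite -mulr_suml big_split /= p_distr.2 -mulr_sumr -/w mS.
apply: le_trans (ler_wpM2r _ (expR_ge1Dx _)) _; first exact: expR_ge0.
rewrite -expRD ler_expR -[r.+1%:R]natr1.
have : 2 * l ^+ 2 * w <= 2 * l ^+ 2 * (B * N%:R).
  by rewrite ler_wpM2l // mulr_ge0 ?sqr_ge0.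
lra.
Qed.

End Unseen.

(* The mean of h under the binomial distribution Bin(m, x), as a polynomial in x. *)
Fixpoint bern (R : realType) (h : nat -> R) m : {poly R} :=
  if m is m'.+1 then (1 - 'X) * bern h m' + 'X * bern (fun a => h a.+1) m'
  else (h 0%N)%:P.

(** * Bernstein polynomials and their derivatives *)

Section Bernstein.
Variable R : realType.
Implicit Types (h : nat -> R) (x : R).

(** For the count of cell [i], all other cells merge into one failure of probability [1 - p i]. *)
Lemma Eseq_count n (p : {ffun 'I_n -> R}) m h i : is_distr p ->
  Eseq p m (fun s => h (count_mem i s)) = (bern h m).[p i].
Proof.
move=> p_distr; elim: m h => [|m IHm] h /=; first by rewrite hornerC.
rewrite !hornerE (bigD1 i) //= eqxx addrC; congr (_ + _).
  rewrite -(sum_distrC p_distr) mulr_suml; apply: eq_bigr => j ji.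
  by rewrite -IHm; congr (_ * _); apply: eq_Eseq => s; rewrite (negPf ji).
by rewrite -IHm.
Qed.

Definition dif h a := h a.+1 - h a.

Lemma eq_bern h1 h2 m : h1 =1 h2 -> bern h1 m = bern h2 m.
Proof.
elim: m h1 h2 => [|m IHm] h1 h2 h12 /=; first by rewrite h12.
by rewrite (IHm h1 h2) // (IHm (fun a => h1 a.+1) (fun a => h2 a.+1)).
Qed.

Lemma bernB h1 h2 m : bern (fun a => h1 a - h2 a) m = bern h1 m - bern h2 m.
Proof.
elim: m h1 h2 => [|m IHm] h1 h2 /=; first by rewrite polyCB.
by rewrite !IHm; ring.
Qed.

(** Product rule on the recursion; writing the shift of [h] as [h + dif h] lets the induction
    hypotheses for both summands combine. *)
Lemma deriv_bern h m : (bern h m.+1)^`() = (bern (dif h) m) *+ m.+1.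
Proof.
elim: m h => [|m IHm] h.
  by rewrite /= !poly.derivE /dif polyCB; ring.
have e : bern (fun a => h a.+1) m.+1
    = bern h m.+1 + ((1 - 'X) * bern (dif h) m + 'X * bern (fun a => dif h a.+1) m).
  by apply/eqP; rewrite addrC -subr_eq -bernB.
have -> : bern h m.+2 = (1 - 'X) * bern h m.+1 + 'X * bern (fun a => h a.+1) m.+1.
  by [].
rewrite derivD !derivM !IHm !poly.derivE e [bern (dif h) m.+1]/=.
ring.
Qed.

End Bernstein.

(** * Lower bounds for binomial point masses *)

(** The function [(2 + x) * exp (- x) + x] equals 2 at 0 and has derivative
    [1 - (1 + x) * exp (- x) >= 0]. *)
Lemma expR_le_pade (R : realType) (z : R) :
  0 <= z -> z < 2 -> expR z <= (2 + z) / (2 - z).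
Proof.
move=> z0 z2.
have [->|zn0] := eqVneq z 0.
  by rewrite expR0 addr0 subr0 divff ?pnatr_eq0.
have zp : 0 < z by rewrite lt_neqAle eq_sym zn0.
pose f (x : R) : R := (2 + x) * expR (- x) + x.
have df (x : R) : is_derive x 1 f (1 - (1 + x) * expR (- x)).
  rewrite /f; apply: is_derive_eq.
  rewrite /GRing.scale /= ; ring.
have [|c] := MVT zp (fun x _ => df x).
  by apply: derivable_within_continuous => x _.
rewrite in_itv /= => /andP[c0 cz] e.
have : f 0 <= f z.
  rewrite -subr_ge0 e mulr_ge0 ?subr_ge0 //.
  by rewrite expRN ler_pdivrMr ?expR_gt0 // mul1r expR_ge1Dx.
rewrite /f oppr0 expR0 mulr1 !addr0 -lerBlDr expRN ler_pdivlMr ?expR_gt0 //.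
by rewrite ler_pdivlMr ?subr_gt0 // mulrC.
Qed.

Section PointMass.
Variable R : realType.

Lemma expn_succ_le K : K.+1%:R ^+ K <= expR 1 * K%:R ^+ K :> R.
Proof.
case: K => [|K]; first by rewrite !expr0 mulr1 ltW // expR_gt1.
have K0 : 0 < K.+1%:R :> R by rewrite ltr0n.
have -> : K.+2%:R = K.+1%:R * (1 + K.+1%:R^-1) :> R.
  by rewrite mulrDr mulr1 divff ?gt_eqF // natr1.
rewrite exprMn mulrC ler_wpM2r ?exprn_ge0 ?ler0n //.
rewrite -[X in expR X](@mulVf _ K.+1%:R) ?gt_eqF // expRM_natr.
by rewrite lerXn2r ?nnegrE ?addr_ge0 ?invr_ge0 ?expR_ge0 ?expR_ge1Dx ?ler0n.
Qed.

(* The square of b! <= e * sqrt b * (b / e)^b, for b = a + 1. *)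
Lemma fact_le_stirling a :
  a.+1`!%:R ^+ 2 * expR 1 ^+ (2 * a) <= a.+1%:R ^+ (2 * a.+1).+1 :> R.
Proof.
elim: a => [|a IHa]; first by rewrite mulr1 expr1n expr1n.
set b : R := a.+1%:R in IHa *.
have b1 : 1 <= b by rewrite ler1n.
have bS : a.+2%:R = b + 1 :> R by rewrite natr1.
(* The square of [e <= (1 + 1 / b) ^ (b + 1 / 2)]. At [z = 2 / (2 * b + 1)] the fraction in
   [expR_le_pade] is exactly [(b + 1) / b]. *)
have e : expR 1 ^+ 2 * b ^+ (2 * a.+1).+1 <= (b + 1) ^+ (2 * a.+1).+1.
  have -> : expR 1 ^+ 2 = expR (2 / (2 * b + 1)) ^+ (2 * a.+1).+1.
    rewrite -expRM_natr -[RHS]expRM_natr mul1r; congr expR.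
    rewrite -[(2 * a.+1).+1%:R]natr1 natrM -/b divfK // gt_eqF //; lra.
  rewrite -exprMn lerXn2r ?nnegrE ?mulr_ge0 ?expR_ge0 //; try lra.
  rewrite -ler_pdivlMr; last by lra.
  apply: le_trans (expR_le_pade _ _) _.
  - by rewrite divr_ge0 //; lra.
  - by rewrite ltr_pdivrMr; lra.
  rewrite le_eqVlt; apply/orP; left; apply/eqP; field.
  by rewrite !gt_eqF //; lra.
rewrite bS factS natrM bS exprMn.
have -> : (2 * a.+1 = (2 * a).+2)%N by rewrite !mul2n doubleS.
have -> : (2 * a.+2).+1 = ((2 * a.+1).+1 + 2)%N by rewrite !mul2n !doubleS addn2.
rewrite [leRHS]exprD -[(2 * a).+2]addn2 [expR 1 ^+ _]exprD.
have h2 : 0 <= (b + 1) ^+ 2 by apply: sqr_ge0.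
have he : 0 <= expR 1 ^+ 2 :> R by apply: sqr_ge0.
apply: le_trans (ler_wpM2r h2 e).
have := ler_wpM2r h2 (ler_wpM2l he IHa).
by congr (_ <= _); ring.
Qed.

(* K^K / K! grows by a factor of at most e when K increases by 1. *)
Lemma point_mass_mode a N :
  (N + a)%:R ^+ (N + a) * N`!%:R <= expR 1 ^+ a * (N + a)`!%:R * N%:R ^+ N :> R.
Proof.
elim: a => [|a IHa]; first by rewrite addn0 expr0 mul1r mulrC.
rewrite addnS factS natrM !exprS.
set M := (N + a)%N in IHa *.
have M0 : 0 <= M.+1%:R :> R by rewrite ler0n.
have f0 : 0 <= N`!%:R :> R by rewrite ler0n.
apply: (@le_trans _ _ (M.+1%:R * (expR 1 * M%:R ^+ M) * N`!%:R)).
  by rewrite ler_wpM2r // ler_wpM2l // expn_succ_le.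
have e0 : 0 <= expR 1 * M.+1%:R :> R by rewrite mulr_ge0 ?expR_ge0.
have := ler_wpM2l e0 IHa.
by congr (_ <= _); ring.
Qed.

Definition pmf (M a : nat) (x : R) : R := 'C(M, a)%:R * x ^+ a * (1 - x) ^+ (M - a).

(** With [N = M - a] the mass is [(M! N^N / (N! M^M)) * (a^a / a!)]. The first factor is at least
    [e^-a] by [point_mass_mode], the second at least [e^a / (e * sqrt (a + 1))] by
    [fact_le_stirling]; [a + 1] under the root admits [a = 0]. *)
Lemma pmf_mode_ge M a : (a <= M)%N -> (0 < M)%N ->
  (expR 1 * Num.sqrt a.+1%:R)^-1 <= pmf M a (a%:R / M%:R).
Proof.
move=> aM M0.
have M0' : 0 < M%:R :> R by rewrite ltr0n.
set N := (M - a)%N.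
have MN : M = (N + a)%N by rewrite subnK.
have -> : pmf M a (a%:R / M%:R)
    = M`!%:R * N%:R ^+ N / (N`!%:R * M%:R ^+ M) * (a%:R ^+ a / a`!%:R).
  have tN : 1 - a%:R / M%:R = N%:R / M%:R :> R.
    by rewrite natrB // mulrBl divff ?gt_eqF.
  have bf : 'C(M, a)%:R * (a`!%:R * N`!%:R) = M`!%:R :> R.
    by rewrite -!natrM bin_fact.
  have fa : a`!%:R != 0 :> R by rewrite pnatr_eq0 -lt0n fact_gt0.
  have fN : N`!%:R != 0 :> R by rewrite pnatr_eq0 -lt0n fact_gt0.
  rewrite /pmf tN -/N -bf !expr_div_n [in M%:R ^+ M]MN exprD -MN.
  by field; rewrite fa fN !expf_neq0 ?gt_eqF.
have fN : 0 < N`!%:R :> R by rewrite ltr0n fact_gt0.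
have MM : 0 < M%:R ^+ M :> R by rewrite exprn_gt0.
have h1 : (expR 1 ^+ a)^-1 <= M`!%:R * N%:R ^+ N / (N`!%:R * M%:R ^+ M) :> R.
  rewrite ler_pdivlMr ?mulr_gt0 // ler_pdivrMl ?exprn_gt0 ?expR_gt0 //.
  by rewrite mulrC mulrA MN; apply: point_mass_mode.
have h2 : (expR 1 * Num.sqrt a.+1%:R)^-1 <= (expR 1 ^+ a)^-1 * (a%:R ^+ a / a`!%:R) :> R.
  have e1 : 1 <= expR 1 :> R by rewrite ltW // expR_gt1.
  have s0 : 0 < expR 1 * Num.sqrt a.+1%:R :> R by rewrite mulr_gt0 ?expR_gt0 ?sqrtr_gt0.
  rewrite mulrA -[leLHS]mul1r ler_pdivrMr // mulrAC ler_pdivlMr ?ltr0n ?fact_gt0 //.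
  rewrite mul1r -mulrA mulrC ler_pdivlMr ?exprn_gt0 ?expR_gt0 //.
  case: (a) => [|b]; first by rewrite !expr0 !mul1r sqrtr1 !mulr1.
  have q0 : 0 <= b.+1`!%:R * expR 1 ^+ b.+1 :> R by rewrite mulr_ge0 ?exprn_ge0 ?expR_ge0.
  have r0 : 0 <= b.+1%:R ^+ b.+1 * (expR 1 * Num.sqrt b.+2%:R) :> R.
    by rewrite !mulr_ge0 ?exprn_ge0 ?expR_ge0 ?sqrtr_ge0.
  rewrite -(ler_pXn2r (n := 2)) // !exprMn sqr_sqrtr ?ler0n // -!exprM.
  have he : 0 <= expR 1 ^+ 2 :> R by apply: sqr_ge0.
  apply: le_trans (_ : expR 1 ^+ 2 * (b.+1%:R ^+ (2 * b.+1).+1) <= _).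
    have := ler_wpM2l he (fact_le_stirling b).
    rewrite [(b.+1 * 2)%N]mulnC -[(2 * b.+1)%N](_ : (2 * b + 2)%N = _); last first.
      by rewrite mulnS addnC.
    by rewrite exprD; congr (_ <= _); ring.
  rewrite [b.+1%:R ^+ _.+1]exprSr mulrCA [(b.+1 * 2)%N]mulnC.
  by rewrite !ler_wpM2l ?exprn_ge0 ?expR_ge0 ?ler_nat.
apply: le_trans h2 _; rewrite ler_wpM2r //.
by rewrite divr_ge0 ?exprn_ge0 ?ler0n.
Qed.

(* The mode of pmf in x is t = a / M; since log y <= y - 1, replacing t by x costs
   at most the exponential of the chi-square distance M (t - x)^2 / (x (1 - x)). *)
Lemma pmf_ge M a (x : R) : (a <= M)%N -> (0 < M)%N -> 0 < x < 1 ->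
  (expR 1 * Num.sqrt a.+1%:R)^-1
    * expR (- ((a%:R - M%:R * x) ^+ 2 / (M%:R * x * (1 - x)))) <= pmf M a x.
Proof.
move=> aM M0 /andP[x0 x1].
have M0' : 0 < M%:R :> R by rewrite ltr0n.
set t := a%:R / M%:R : R.
have aE : a%:R = M%:R * t by rewrite mulrC divfK ?gt_eqF.
have t0 : 0 <= t by rewrite divr_ge0.
have t1 : 0 <= 1 - t by rewrite subr_ge0 ler_pdivrMr ?mul1r ?ler_nat.
have y0 : 0 < 1 - x by rewrite subr_gt0.
have tilt (u v : R) k : 0 <= u -> 0 < v -> u ^+ k <= v ^+ k * expR (k%:R * (u / v - 1)).
  move=> u0 v0; rewrite expRM_natl -exprMn.
  rewrite lerXn2r ?nnegrE ?mulr_ge0 ?expR_ge0 ?(ltW v0) //.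
  rewrite -ler_pdivrMl // mulrC; have := expR_ge1Dx (u / v - 1).
  by rewrite addrC subrK.
rewrite expRN -ler_pdivlMr ?invr_gt0 ?expR_gt0 // invrK.
apply: le_trans (pmf_mode_ge aM M0) _; rewrite -/t /pmf -!mulrA ler_wpM2l ?ler0n //.
apply: (@le_trans _ _ (x ^+ a * expR (a%:R * (t / x - 1)) *
    ((1 - x) ^+ (M - a) * expR ((M - a)%:R * ((1 - t) / (1 - x) - 1))))).
  by rewrite ler_pM ?exprn_ge0 ?tilt.
rewrite le_eqVlt; apply/orP; left; apply/eqP.
rewrite mulrACA -mulrA -expRD; congr (_ * (_ * expR _)).
rewrite natrB // aE; field.
by rewrite !gt_eqF.
Qed.

End PointMass.

(** * Stochastic domination under transfers of mass *)

Lemma deriv_prod (R : comNzRingType) m (F : 'I_m -> {poly R}) :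
  (\prod_k F k)^`() = \sum_l (F l)^`() * \prod_(k | k != l) F k.
Proof.
elim: m F => [|m IHm] F; first by rewrite !big_ord0 derivC.
rewrite big_ord_recl derivM IHm [in RHS]big_ord_recl; congr (_ * _ + _).
  by rewrite [in RHS]big_mkcond big_ord_recl /= mul1r.
rewrite mulr_sumr; apply: eq_bigr => l _.
rewrite [in RHS]big_mkcond big_ord_recl /= -big_mkcond mulrCA; congr (_ * (_ * _)).
Qed.

Definition relabel n m (s : 'S_n) (x : sample n m) : sample n m :=
  [ffun k => s (x k)].

Definition relabel_at n m (l : 'I_m) (s : 'S_n) (x : sample n m) : sample n m :=
  [ffun k => if k == l then s (x k) else x k].

Definition occ_but n m (l : 'I_m) (x : sample n m) (i : 'I_n) : nat :=
  #|[pred k | (k != l) && (x k == i)]|.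

Lemma occ_occ_but n m (l : 'I_m) (x : sample n m) i :
  occ x i = ((x l == i) + occ_but l x i)%N.
Proof.
rewrite /occ (cardsD1 l) inE; congr (_ + _)%N.
by apply: eq_card => k; rewrite !inE.
Qed.

Lemma occ_but_relabel_at n m (l : 'I_m) (s : 'S_n) (x : sample n m) i :
  occ_but l (relabel_at l s x) i = occ_but l x i.
Proof.
by apply: eq_card => k; rewrite !inE ffunE; case: eqP.
Qed.

Lemma occ_but_relabel n m (l : 'I_m) (s : 'S_n) (x : sample n m) i :
  occ_but l (relabel s x) (s i) = occ_but l x i.
Proof.
by apply: eq_card => k; rewrite !inE ffunE (inj_eq perm_inj).
Qed.

Lemma occ_relabel n m (s : 'S_n) (x : sample n m) i :
  occ (relabel s x) (s i) = occ x i.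
Proof.
by apply: eq_card => k; rewrite !inE ffunE (inj_eq perm_inj).
Qed.

Section Transfer.
Variables (R : realType) (n m : nat) (i j : 'I_n).
Hypothesis ij : i != j.
Let s := tperm i j.

Lemma tperm_eql a : (s a == i) = (a == j).
Proof. by rewrite -[in LHS](tpermR i j) (inj_eq perm_inj). Qed.

Lemma tperm_eqr a : (s a == j) = (a == i).
Proof. by rewrite -[in LHS](tpermL i j) (inj_eq perm_inj). Qed.

Lemma relabel_tpermK : involutive (@relabel n m s).
Proof. by move=> x; apply/ffunP => k; rewrite !ffunE tpermK. Qed.

Lemma relabel_at_tpermK l : involutive (@relabel_at n m l s).
Proof.
by move=> x; apply/ffunP => k; rewrite !ffunE; case: eqP => // _; rewrite tpermK.
Qed.

Lemma relabel_at_relabel l (x : sample n m) :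
  relabel_at l s (relabel s x) = relabel s (relabel_at l s x).
Proof. by apply/ffunP => k; rewrite !ffunE; case: eqP. Qed.

(** Isolates the powers of [P i] and [P j]: swapping the labels exchanges the two exponents and
    keeps the last factor. *)
Lemma prod_but (P : 'I_n -> R) l (x : sample n m) :
  \prod_(k | k != l) P (x k) = P i ^+ occ_but l x i * P j ^+ occ_but l x j
    * \prod_(k | (k != l) && (x k \notin [:: i; j])) P (x k).
Proof.
rewrite (bigID (fun k => x k == i)) /=.
rewrite (eq_bigr (fun=> P i)); last by move=> k /andP[_ /eqP ->].
rewrite prodr_const -mulrA; congr (_ * _).
rewrite (bigID (fun k => x k == j)) /=.
rewrite (eq_bigr (fun=> P j)); last by move=> k /andP[_ /eqP ->].
rewrite prodr_const; congr (_ ^+ _ * _).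
  apply: eq_card => k; rewrite inE unfold_in.
  by case: (x k =P j) => [->|_]; rewrite ?andbF // [j == i]eq_sym ij !andbT.
by apply: eq_bigl => k; rewrite !inE negb_or andbA.
Qed.

Lemma prod_but_relabel (P : 'I_n -> R) l (x : sample n m) :
  \prod_(k | k != l) P (relabel s x k)
    = P i ^+ occ_but l x j * P j ^+ occ_but l x i
    * \prod_(k | (k != l) && (x k \notin [:: i; j])) P (x k).
Proof.
rewrite prod_but; congr (_ ^+ _ * _ ^+ _ * _).
- by rewrite -[in LHS](tpermR i j) -/s occ_but_relabel.
- by rewrite -[in LHS](tpermL i j) -/s occ_but_relabel.
have e k : (relabel s x k \notin [:: i; j]) = (x k \notin [:: i; j]).
  by rewrite ffunE !inE tperm_eql tperm_eqr orbC.
apply: eq_big => k; first by rewrite e.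
rewrite e !inE negb_or ffunE => /and3P[_ ki kj].
by rewrite /s tpermD // eq_sym.
Qed.

Definition transfer (p : {ffun 'I_n -> R}) (t : R) : {ffun 'I_n -> R} :=
  [ffun k => p k + t * ((k == i)%:R - (k == j)%:R)].

Variables (phi : sample n m -> R).
Hypothesis phi_sym : forall x, phi (relabel s x) = phi x.
Hypothesis phi_mono : forall l (x : sample n m), x l = i ->
  (occ_but l x j <= occ_but l x i)%N -> phi x <= phi (relabel_at l s x).

(** The two differences have opposite signs. If the other draws hit [i] at least as often as [j],
    then moving draw [l] to [j] raises [phi], while [P j <= P i] makes the original product the
    larger one. Otherwise both signs flip, by the symmetry of [phi]. *)
Lemma transfer_term_le0 (P : 'I_n -> R) l (x : sample n m) :
    (forall k, 0 <= P k) -> P j <= P i -> x l = i ->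
  (phi x - phi (relabel_at l s x)) *
  (\prod_(k | k != l) P (x k) - \prod_(k | k != l) P (relabel s x k)) <= 0.
Proof.
move=> P0 Pji xl; rewrite prod_but prod_but_relabel -mulrBl mulrA.
rewrite mulr_le0_ge0 //; last by apply: prodr_ge0.
have pow a b : (b <= a)%N -> 0 <= P i ^+ a * P j ^+ b - P i ^+ b * P j ^+ a.
  move=> ba; rewrite -(subnK ba) !exprD.
  rewrite (_ : _ - _ = P i ^+ b * P j ^+ b * (P i ^+ (a - b) - P j ^+ (a - b)));
    last by ring.
  by rewrite !mulr_ge0 ?exprn_ge0 // subr_ge0 lerXn2r ?nnegrE.
have [le_ji|/ltnW le_ij] := leqP (occ_but l x j) (occ_but l x i).
  by rewrite mulr_le0_ge0 ?pow // subr_le0 phi_mono.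
rewrite mulr_ge0_le0 //; last by rewrite -oppr_ge0 opprB pow.
rewrite subr_ge0 -[leRHS]phi_sym -[leLHS]phi_sym -[in leRHS](relabel_at_tpermK l x).
rewrite -[in leRHS]relabel_at_relabel; apply: phi_mono.
  by rewrite !ffunE eqxx xl /s tpermL tpermR.
rewrite -{1}(tpermL i j) -{3}(tpermR i j) -/s !occ_but_relabel.
by rewrite !occ_but_relabel_at.
Qed.

(* Swapping the labels i and j everywhere negates d (x l) and fixes phi; swapping
   them at position l alone negates d (x l) and fixes the product.  Averaging over
   both involutions leaves terms with a constant sign. *)
Lemma transfer_deriv_le0 (P : 'I_n -> R) l :
    (forall k, 0 <= P k) -> P j <= P i ->
  \sum_(x : sample n m) ((x l == i)%:R - (x l == j)%:R)
    * \prod_(k | k != l) P (x k) * phi x <= 0.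
Proof.
move=> P0 Pji; set d := fun a : 'I_n => (a == i)%:R - (a == j)%:R : R.
have ds a : d (s a) = - d a.
  by rewrite /d tperm_eql tperm_eqr opprB.
set w := fun x : sample n m => \prod_(k | k != l) P (x k).
rewrite -[leLHS]/(\sum_(x : sample n m) d (x l) * w x * phi x); set A := \sum_x _.
have A1 : A = - \sum_(x : sample n m) d (x l) * w (relabel s x) * phi x.
  rewrite /A (reindex_inj (inv_inj relabel_tpermK)) -sumrN.
  apply: eq_bigr => x _; rewrite phi_sym -!mulNr; congr (_ * _ * _).
  by rewrite ffunE ds.
have A2 : A + A = \sum_(x : sample n m) d (x l) * (w x - w (relabel s x)) * phi x.
  rewrite {2}A1 /A -sumrB; apply: eq_bigr => x _; rewrite -/(w x); ring.
have wat (x : sample n m) : w (relabel_at l s x) = w x.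
  by apply: eq_bigr => k kl; rewrite ffunE (negPf kl).
have wats (x : sample n m) : w (relabel s (relabel_at l s x)) = w (relabel s x).
  by apply: eq_bigr => k kl; rewrite !ffunE (negPf kl).
have A3 : A + A = - \sum_(x : sample n m) d (x l) * (w x - w (relabel s x))
    * phi (relabel_at l s x).
  rewrite A2 (reindex_inj (inv_inj (relabel_at_tpermK l))) -sumrN.
  apply: eq_bigr => x _; rewrite wat wats -!mulNr; congr (_ * _ * _).
  by rewrite ffunE eqxx ds.
have A4 : (A + A) + (A + A) = \sum_(x : sample n m) d (x l)
    * ((phi x - phi (relabel_at l s x)) * (w x - w (relabel s x))).
  by rewrite {2}A3 {1}A2 -sumrB; apply: eq_bigr => x _; ring.
suff : (A + A) + (A + A) <= 0 by lra.
rewrite A4; apply: sumr_le0 => x _.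
rewrite /d; have [xi|xi] := eqVneq (x l) i.
  rewrite xi (negPf ij) subr0 mul1r; exact: transfer_term_le0.
have [xj|xj] := eqVneq (x l) j; last by rewrite subrr mul0r.
rewrite sub0r mulN1r -mulNr opprB -wat -[w (relabel s x)]wats.
rewrite -{2}(relabel_at_tpermK l x); apply: transfer_term_le0 => //.
by rewrite ffunE eqxx xj /s tpermR.
Qed.

(** The expectation is a polynomial [G] in the transferred mass. Its derivative is a sum over the
    draws [l] of terms as in [transfer_deriv_le0], taken at an intermediate transfer, where the
    weights are still nonnegative and ordered; the mean value theorem concludes. *)
Lemma E_iid_transfer (q : {ffun 'I_n -> R}) t :
    (forall k, 0 <= q k) -> q j <= q i -> 0 <= t <= q j ->
  E_iid (transfer q t) phi <= E_iid q phi.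
Proof.
move=> q0 qji /andP[t0 tj].
pose d (a : 'I_n) : R := (a == i)%:R - (a == j)%:R.
pose Q a : {poly R} := (q a)%:P + (d a)%:P * 'X.
pose G := \sum_(x : sample n m) (\prod_k Q (x k)) * (phi x)%:P.
have QE u a : (Q a).[u] = transfer q u a.
  by rewrite !hornerE ffunE mulrC.
have GE u : G.[u] = E_iid (transfer q u) phi.
  rewrite horner_sum; apply: eq_bigr => x _.
  rewrite hornerM hornerC horner_prod; congr (_ * _).
  by apply: eq_bigr => k _; rewrite QE.
have G0 : G.[0] = E_iid q phi.
  rewrite GE; congr (E_iid _ phi); apply/ffunP => k.
  by rewrite ffunE mul0r addr0.
have [t_eq0|t_neq0] := eqVneq t 0; first by rewrite -G0 -GE t_eq0.
have t_gt0 : 0 < t by rewrite lt_neqAle eq_sym t_neq0.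
rewrite -GE -G0 -subr_le0; case: (poly_mvt G t_gt0) => c.
rewrite in_itv /= => /andP[c0 ct] ->; rewrite subr0 mulr_le0_ge0 //.
rewrite /G raddf_sum horner_sum /=.
rewrite (eq_bigr (fun x : sample n m => \sum_l d (x l)
    * \prod_(k | k != l) transfer q c (x k) * phi x)); last first.
  move=> x _; rewrite derivM derivC mulr0 addr0 deriv_prod hornerM hornerC.
  rewrite horner_sum mulr_suml; apply: eq_bigr => l _; congr (_ * _).
  rewrite hornerM horner_prod; congr (_ * _).
    by rewrite /Q !poly.derivE !hornerE.
  by apply: eq_bigr => k _; rewrite QE.
rewrite exchange_big /=; apply: sumr_le0 => l _.
apply: transfer_deriv_le0 => [k|].
  rewrite ffunE; case: (eqVneq k j) => [->|_]; last first.
    by rewrite subr0 addr_ge0 // mulr_ge0 // ltW.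
  by rewrite eq_sym (negPf ij) /=; lra.
by rewrite !ffunE !eqxx [j == i]eq_sym (negPf ij) /=; lra.
Qed.

End Transfer.

Lemma tv_stat_relabel (R : realType) n m (s : 'S_n) (x : sample n m) :
  tv_stat R (relabel s x) = tv_stat R x.
Proof.
rewrite /tv_stat; congr (_ * _); rewrite (reindex_inj (@perm_inj _ s)) /=.
by apply: eq_bigr => i _; rewrite occ_relabel.
Qed.

(** Only the terms of [i] and [j] change. With [b <= a] other draws in [j] and [i], convexity of the
    absolute value makes the counts [(a, b + 1)] cost no more than [(a + 1, b)]. *)
Lemma tv_stat_relabel_at (R : realType) n m (i j : 'I_n) l (x : sample n m) :
    i != j -> x l = i -> (occ_but l x j <= occ_but l x i)%N ->
  tv_stat R (relabel_at l (tperm i j) x) <= tv_stat R x.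
Proof.
move=> ij xl ji; rewrite /tv_stat ler_wpM2l ?invr_ge0 ?ler0n //.
rewrite (bigD1 i) //= (bigD1 j) 1?eq_sym //= [leRHS](bigD1 i) //=.
rewrite [in leRHS](bigD1 j) 1?eq_sym //= !addrA.
apply: lerD; last first.
  apply: ler_sum => k /andP[ki kj]; rewrite !(occ_occ_but l) ffunE eqxx xl.
  by rewrite tpermL occ_but_relabel_at eq_sym (negPf kj) eq_sym (negPf ki).
rewrite !(occ_occ_but l) ffunE eqxx xl tpermL !occ_but_relabel_at !eqxx.
rewrite [j == i]eq_sym (negPf ij) !add0n !add1n.
move: (occ_but l x i) (occ_but l x j) ji => a b ba.
rewrite -!natr1 !mulrDl mul1r.
have : b%:R / m%:R <= a%:R / m%:R :> R by rewrite ler_wpM2r ?invr_ge0 ?ler_nat.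
have : 0 <= m%:R^-1 :> R by rewrite invr_ge0.
move: (n%:R^-1) (m%:R^-1) (a%:R / m%:R) (b%:R / m%:R) => c w v u.
by case: (ger0P (u - c)); case: (ger0P (v - c)); case: (ger0P (u + w - c));
  case: (ger0P (v + w - c)); lra.
Qed.

(** * Majorization and reduction to two-level distributions *)

Section Majorization.
Variables (R : realType) (n m : nat) (g : R -> R).
Hypothesis g_noninc : forall a b, a <= b -> g b <= g a.
(** Comparing means for every nonincreasing [g] is stochastic domination of S; lower tails
    correspond to indicator functions [g]. *)
Let phi (x : sample n m) := g (tv_stat R x).

(* Each step moves mass from a cell above its target q i to a cell below its target
   q j until one of the two targets is met; the cells never cross as q j <= q i. *)
Lemma E_iid_spread (p q : {ffun 'I_n -> R}) :
    (forall k, 0 <= p k) -> \sum_k p k = \sum_k q k ->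
    (forall i j, q i < p i -> p j < q j -> q j <= q i) ->
  E_iid p phi <= E_iid q phi.
Proof.
have [N] := ubnP #|[pred k | p k != q k]|.
elim: N p => // N IHN p ltN p0 sum_pq pq.
have [/eqP -> //|neq_pq] := boolP (p == q).
have [k0 pqk0] : exists k, p k != q k.
  apply/existsP; apply: contraNT neq_pq; rewrite negb_exists => /forallP h.
  by apply/eqP/ffunP => k; apply/eqP; rewrite -[_ == _]negbK h.
have [i qi] : exists i, q i < p i.
  apply/existsP; rewrite -[X in is_true X]negbK negb_exists; apply/negP => /forallP h.
  have /eqP : \sum_k (q k - p k) = 0 by rewrite sumrB sum_pq subrr.
  rewrite psumr_eq0; last by move=> k _; rewrite subr_ge0 leNgt h.
  by move=> /allP /(_ k0 (mem_index_enum _)); rewrite subr_eq0 eq_sym (negPf pqk0).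
have [j qj] : exists j, p j < q j.
  apply/existsP; rewrite -[X in is_true X]negbK negb_exists; apply/negP => /forallP h.
  have /eqP : \sum_k (p k - q k) = 0 by rewrite sumrB sum_pq subrr.
  rewrite psumr_eq0; last by move=> k _; rewrite subr_ge0 leNgt h.
  by move=> /allP /(_ k0 (mem_index_enum _)); rewrite subr_eq0 (negPf pqk0).
have qji := pq _ _ qi qj.
have ij : i != j by apply: contraTneq qi => ->; rewrite -leNgt ltW.
pose t := Num.min (p i - q i) (q j - p j).
have t0 : 0 < t by rewrite lt_min !subr_gt0 qi qj.
have ti : t <= p i - q i by rewrite ge_min lexx.
have tj : t <= q j - p j by rewrite ge_min lexx orbT.
pose p' := transfer j i p t.
have p'i : p' i = p i - t.
  by rewrite ffunE eqxx (negPf ij) /= sub0r mulrN1.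
have p'j : p' j = p j + t.
  by rewrite ffunE eqxx [j == i]eq_sym (negPf ij) /= subr0 mulr1.
have p'k k : k != i -> k != j -> p' k = p k.
  by move=> ki kj; rewrite ffunE (negPf ki) (negPf kj) subrr mulr0 addr0.
have p'0 k : 0 <= p' k.
  have [->|ki] := eqVneq k i; first by rewrite p'i; have := p0 j; lra.
  have [->|kj] := eqVneq k j; first by rewrite p'j; have := p0 j; lra.
  by rewrite p'k.
(* Read backwards, [p] arises from [p'] by moving [t] from the lighter cell [j] to the heavier cell
   [i], the direction of [E_iid_transfer]; indeed [p' j <= q j <= q i <= p' i]. *)
have pE : p = transfer i j p' t.
  by apply/ffunP => k; rewrite !ffunE; ring.
apply: (@le_trans _ _ (E_iid p' phi)).
  rewrite {1}pE; apply: E_iid_transfer => //.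
  - by move=> x; rewrite /phi tv_stat_relabel.
  - by move=> l x xl occ_ji; apply: g_noninc; apply: tv_stat_relabel_at.
  - by rewrite p'i p'j; lra.
  by rewrite p'j ltW //=; have := p0 j; lra.
apply: IHN => //.
- have [k [kpq kp']] : exists k, p k != q k /\ p' k = q k.
    have [pi|pj] := leP (p i - q i) (q j - p j).
      exists i; rewrite gt_eqF //; split=> //.
      by rewrite p'i /t (min_idPl pi); ring.
    exists j; rewrite lt_eqF //; split=> //.
    by rewrite p'j /t (min_idPr (ltW pj)); ring.
  rewrite -ltnS; apply: leq_trans ltN; rewrite ltnS; apply: proper_card.
  apply/properP; split; last by exists k; rewrite !inE ?kp' ?eqxx.
  apply/subsetP => a; rewrite !inE.
  have [->|ai] := eqVneq a i; first by rewrite (gt_eqF qi).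
  have [->|aj] := eqVneq a j; first by rewrite (lt_eqF qj).
  by rewrite p'k.
- rewrite -sum_pq /p'; under eq_bigr do rewrite ffunE.
  rewrite big_split /= -mulr_sumr sumrB.
  have sum1 a : \sum_(k < n) (k == a)%:R = 1 :> R.
    by rewrite (bigD1 a) //= eqxx big1 ?addr0 // => k /negPf ->.
  by rewrite !sum1 subrr mulr0 addr0.
move=> a b qa qb; apply: pq.
  have [->//|ai] := eqVneq a i; move: qa.
  have [->|aj] := eqVneq a j; first by rewrite p'j; lra.
  by rewrite p'k.
have [bj|bj] := eqVneq b j; first by rewrite bj.
move: qb; have [->|bi] := eqVneq b i; first by rewrite p'i; lra.
by rewrite p'k.
Qed.

Lemma sum_const_div (T : {set 'I_n}) (a : R) : (0 < #|T|)%N ->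
  \sum_(k in T) a / #|T|%:R = a.
Proof.
move=> T0; rewrite sumr_const -[(a / _) *+ _]mulr_natr divfK //.
by rewrite pnatr_eq0 -lt0n.
Qed.

Definition average (T : {set 'I_n}) (p : {ffun 'I_n -> R}) : {ffun 'I_n -> R} :=
  [ffun k => if k \in T then (\sum_(i in T) p i) / #|T|%:R else p k].

Lemma average_ge0 (T : {set 'I_n}) (p : {ffun 'I_n -> R}) :
  (forall k, 0 <= p k) -> forall k, 0 <= average T p k.
Proof.
by move=> p0 k; rewrite ffunE; case: ifP => // _; rewrite divr_ge0 ?sumr_ge0.
Qed.

Lemma sum_averageC (T : {set 'I_n}) (p : {ffun 'I_n -> R}) :
  \sum_(k | k \notin T) average T p k = \sum_(k | k \notin T) p k.
Proof. by apply: eq_bigr => k /negPf kT; rewrite ffunE kT. Qed.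

Lemma sum_average (T : {set 'I_n}) (p : {ffun 'I_n -> R}) :
  (0 < #|T|)%N -> \sum_k average T p k = \sum_k p k.
Proof.
move=> T0; rewrite (bigID (mem T)) [RHS](bigID (mem T)) /= sum_averageC.
congr (_ + _); rewrite (eq_bigr (fun=> (\sum_(i in T) p i) / #|T|%:R)).
  exact: sum_const_div.
by move=> k kT; rewrite ffunE kT.
Qed.

Lemma E_iid_average (T : {set 'I_n}) (p : {ffun 'I_n -> R}) :
  (0 < #|T|)%N -> (forall k, 0 <= p k) ->
  E_iid p phi <= E_iid (average T p) phi.
Proof.
move=> T0 p0; apply: E_iid_spread; rewrite ?sum_average //.
move=> i j; rewrite !ffunE.
by case: ifP; case: ifP => //; rewrite ltxx.
Qed.

Definition two_level (T : {set 'I_n}) (e : R) : {ffun 'I_n -> R} :=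
  [ffun k => if k \in T then n%:R^-1 + e / #|T|%:R else n%:R^-1 - e / #|~: T|%:R].

Lemma two_levelE (T : {set 'I_n}) e k : two_level T e k
  = if k \in T then n%:R^-1 + e / #|T|%:R else n%:R^-1 - e / #|~: T|%:R.
Proof. by rewrite ffunE. Qed.

Lemma sum_two_level (T : {set 'I_n}) e : (0 < #|T|)%N -> (0 < #|~: T|)%N ->
  \sum_k two_level T e k = 1.
Proof.
move=> T0 Tc0; have n0 : n%:R != 0 :> R.
  rewrite pnatr_eq0 -lt0n; apply: leq_trans T0 _.
  by have := max_card (mem T); rewrite card_ord.
rewrite (bigID (mem T)) /=.
rewrite (eq_bigr (fun=> n%:R^-1 + e / #|T|%:R)) => [|k kT]; last first.
  by rewrite ffunE kT.
rewrite big_split /= sum_const_div // sumr_const.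
rewrite (eq_bigr (fun=> n%:R^-1 - e / #|~: T|%:R)); last first.
  by move=> k /negPf kT; rewrite ffunE kT.
rewrite (eq_bigl (mem (~: T))) => [|k]; last by rewrite !inE.
rewrite sumrB sum_const_div // sumr_const addrACA subrr addr0.
by rewrite -mulrnDr cardsC card_ord -[_ *+ n]mulr_natl mulfV.
Qed.

(** After averaging over [T] and over its complement, the cells of [T] are at or above their targets
    and the others at or below. Shrinking the excess to [e] is then a spreading step. *)
Lemma E_iid_two_level (T : {set 'I_n}) e (p : {ffun 'I_n -> R}) :
    (0 < #|T|)%N -> (0 < #|~: T|)%N -> is_distr p ->
    0 <= e <= \sum_(k in T) (p k - n%:R^-1) ->
  E_iid p phi <= E_iid (two_level T e) phi.
Proof.
move=> T0 Tc0 [p0 p1] /andP[e0 eT].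
apply: le_trans (E_iid_average T0 p0) _.
apply: le_trans (E_iid_average Tc0 (average_ge0 T p0)) _.
have nT : #|T|%:R + #|~: T|%:R = n%:R :> R by rewrite -natrD cardsC card_ord.
have T0' : 0 < #|T|%:R :> R by rewrite ltr0n.
have Tc0' : 0 < #|~: T|%:R :> R by rewrite ltr0n.
have Tn : n%:R != 0 :> R by rewrite -nT gt_eqF // addr_gt0.
set S := \sum_(k in T) p k.
have eS : e <= S - #|T|%:R / n%:R.
  by move: eT; rewrite sumrB sumr_const -[_ *+ #|T|]mulr_natl.
set q := average _ _.
have qT k : k \in T -> q k = S / #|T|%:R.
  by move=> kT; rewrite /q ffunE inE kT /= ffunE kT.
have qTc k : k \notin T -> q k = (1 - S) / #|~: T|%:R.
  move=> kT; rewrite /q ffunE inE kT; congr (_ / _).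
  rewrite (eq_bigl (fun k => k \notin T)) => [|i]; last by rewrite inE.
  rewrite sum_averageC -p1 [in RHS](bigID (mem T)) /= -/S.
  by rewrite addrC addrK.
have q0 : forall k, 0 <= q k by do 2! apply: average_ge0.
have hT k : k \in T -> n%:R^-1 + e / #|T|%:R <= q k.
  move=> kT; rewrite qT // ler_pdivlMr // mulrDl divfK ?gt_eqF //.
  by move: eS; rewrite mulrC; lra.
have hTc k : k \notin T -> q k <= n%:R^-1 - e / #|~: T|%:R.
  move=> kT; rewrite qTc // ler_pdivrMr // mulrBl divfK ?gt_eqF //.
  have : #|~: T|%:R / n%:R = 1 - #|T|%:R / n%:R :> R.
    by rewrite -nT; field; rewrite nT.
  by move: eS; rewrite [_^-1 * _]mulrC; lra.
apply: E_iid_spread => //.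
  by rewrite !sum_average // sum_two_level.
move=> i j; rewrite !two_levelE; case: ifPn => iT; case: ifPn => jT //.
- move=> _ _; have := divr_ge0 e0 (ltW T0'); have := divr_ge0 e0 (ltW Tc0').
  lra.
- by move=> _; rewrite ltNge hT.
Qed.

End Majorization.

Lemma exists_heavy_set (R : realType) n k (d : 'I_n -> R) :
    (0 < k)%N -> (k.*2 <= n)%N -> \sum_i d i = 0 ->
  exists2 T : {set 'I_n}, #|T| = k
    & k%:R * (2^-1 * \sum_i `|d i|) <= n%:R * \sum_(i in T) d i.
Proof.
move=> k0 k2n d0.
have kn : (k <= n)%N by apply: leq_trans k2n; rewrite -addnn leq_addr.
have [T0 T0k] : exists T0 : {set 'I_n}, #|T0| == k.
  exists [set x in take k (enum 'I_n)].
  rewrite cardsE (card_uniqP _); last by rewrite take_uniq // enum_uniq.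
  by rewrite size_takel // size_enum_ord.
pose S (T : {set 'I_n}) := \sum_(i in T) d i.
(* T maximizes the sum among k-sets, so d is larger on T than off T.  If d a, its
   minimum on T, is nonnegative then T collects at least the share k / n of the
   positive part of d; otherwise its complement does so for the negative part. *)
case: (@arg_maxP _ _ _ T0 (fun T : {set 'I_n} => #|T| == k) S T0k) => T /eqP Tk Tmax.
have swap i j : i \in T -> j \notin T -> d j <= d i.
  move=> iT jT.
  have jTi : j \notin T :\ i by rewrite !inE (negPf jT) andbF.
  have := Tmax (j |: T :\ i); rewrite cardsU1 jTi -Tk [#|T|](cardsD1 i) iT eqxx.
  move=> /(_ isT); rewrite /S big_setU1 //= [in leRHS](big_setD1 i) //=.
  by rewrite lerD2r.
exists T => //; rewrite -/(S T).
have [i0 i0T] : exists i0, i0 \in T by apply/set0Pn; rewrite -card_gt0 Tk.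
case: (@arg_minP _ _ _ i0 (fun i => i \in T) d i0T) => a aT amin.
have STc : \sum_(i | i \notin T) d i = - S T.
  by move: d0; rewrite (bigID (mem T)) /= -/(S T) => /eqP; rewrite addrC addr_eq0 => /eqP.
have cTc : \sum_(i | i \notin T) d a = (n%:R - k%:R) * d a.
  rewrite (eq_bigl (mem (~: T))) => [|i]; last by rewrite !inE.
  by rewrite sumr_const cardsCs setCK card_ord Tk -[_ *+ _]mulr_natl natrB.
have cT : \sum_(i in T) d a = k%:R * d a by rewrite sumr_const Tk -[_ *+ _]mulr_natl.
have SaT : k%:R * d a <= S T by rewrite -cT; apply: ler_sum.
have SaTc : - S T <= (n%:R - k%:R) * d a.
  by rewrite -cTc -STc; apply: ler_sum => i iT; apply: swap.
have k0' : 0 < k%:R :> R by rewrite ltr0n.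
have k2n' : 2 * k%:R <= n%:R :> R by rewrite -natrM ler_nat mul2n.
have [a0|a0] := leP 0 (d a).
  (* Off [T] each [d i] is at most [d a], so [2 * d a - d i] bounds its absolute value whatever its
     sign. *)
  have : \sum_i `|d i| <= S T + \sum_(i | i \notin T) (2 * d a - d i).
    rewrite (bigID (mem T)) /=; apply: lerD.
      by apply: ler_sum => i iT; rewrite ger0_norm // (le_trans a0) ?amin.
    apply: ler_sum => i iT; have := swap _ _ aT iT.
    by case: (ger0P (d i)); lra.
  rewrite sumrB -mulr_sumr cTc STc.
  by nra.
have : \sum_i `|d i| <= \sum_(i in T) (d i - 2 * d a) + \sum_(i | i \notin T) - d i.
  rewrite (bigID (mem T)) /=; apply: lerD; apply: ler_sum => i iT.
    by have := amin i iT; case: (ger0P (d i)); lra.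
  by rewrite ltr0_norm // (le_lt_trans _ a0) ?swap.
rewrite sumrB sumrN -mulr_sumr cT STc -/(S T) => h.
have ST0 : 0 <= S T by nra.
have h1 : 2^-1 * \sum_i `|d i| <= S T - k%:R * d a by lra.
have h0 : 0 <= 2^-1 * \sum_i `|d i| by rewrite mulr_ge0 ?invr_ge0 ?sumr_ge0.
(* Here [2 * k <= n] allows the factor [k] to be replaced by [n - k], after which [SaTc] applies. *)
apply: (@le_trans _ _ ((n%:R - k%:R) * (S T - k%:R * d a))).
  apply: ler_pM => //; lra.
nra.
Qed.

(** * The gap between the means *)

Section BernsteinBounds.
Variable R : realType.
Implicit Types (h : nat -> R) (x : R).

Lemma bern_ge0 h M x : (forall a, 0 <= h a) -> 0 <= x <= 1 -> 0 <= (bern h M).[x].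
Proof.
move=> h0 /andP[x0 x1]; elim: M h h0 => [|M IHM] h h0 /=; first by rewrite hornerC.
by rewrite !hornerE addr_ge0 // mulr_ge0 ?subr_ge0 ?IHM.
Qed.

Lemma pmf0 M x : pmf M 0 x = (1 - x) ^+ M.
Proof. by rewrite /pmf bin0 expr0 !mul1r subn0. Qed.

Lemma pmfS M a x : pmf M.+1 a.+1 x = (1 - x) * pmf M a.+1 x + x * pmf M a x.
Proof.
rewrite /pmf binS natrD subSS.
have [aM|Ma] := ltnP a M; last first.
  rewrite (@bin_small M a.+1) // mulr0n add0r !mul0r mulr0 add0r exprS; ring.
by rewrite -subnSK // !exprS; ring.
Qed.

Lemma pmf_bern h M a x : (forall b, 0 <= h b) -> 0 <= x <= 1 ->
  h a * pmf M a x <= (bern h M).[x].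
Proof.
move=> h0 x01; have /andP[x0 x1] := x01.
have y0 : 0 <= 1 - x by rewrite subr_ge0.
elim: M h a h0 => [|M IHM] h [|a] h0 /=; rewrite ?hornerC.
- by rewrite pmf0 expr0 mulr1.
- by rewrite /pmf bin0n /= !mul0r mulr0.
- rewrite pmf0 !hornerE exprS mulrCA ler_wpDr //.
    by rewrite mulr_ge0 // bern_ge0.
  by rewrite ler_wpM2l // -pmf0 IHM.
rewrite pmfS mulrDr hornerD !hornerM hornerD hornerN hornerX hornerC; apply: lerD.
  by rewrite mulrCA ler_wpM2l // IHM.
by rewrite mulrCA ler_wpM2l //; apply: (IHM (fun b => h b.+1)).
Qed.

(** Subtracting the quadratic leaves [q] with [q] and its derivative zero at [x] and second
    derivative nonnegative on the interval; two mean value steps give [0 <= q.[y]]. *)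
Lemma poly_taylor2_ge (p : {poly R}) lo hi B x y :
    (forall z, lo <= z <= hi -> B <= p^`()^`().[z]) ->
    lo <= x <= hi -> lo <= y <= hi ->
  p.[x] + p^`().[x] * (y - x) + B / 2 * (y - x) ^+ 2 <= p.[y].
Proof.
move=> pB /andP[lx xh] /andP[ly yh].
pose q := p - (p.[x])%:P - (p^`().[x])%:P * ('X - x%:P)
          - (B / 2)%:P * ('X - x%:P) ^+ 2.
have qx : q.[x] = 0 by rewrite !hornerE /=; ring.
have q'E : q^`() = p^`() - (p^`().[x])%:P - (B)%:P * ('X - x%:P).
  rewrite /q !poly.derivE.
  have -> : B%:P = (B / 2)%:P + (B / 2)%:P by rewrite -polyCD; congr (_%:P); lra.
  by ring.
have q'x : q^`().[x] = 0 by rewrite q'E !hornerE /=; ring.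
have q''0 z : lo <= z <= hi -> 0 <= q^`()^`().[z].
  move=> /pB; rewrite q'E !poly.derivE !hornerE /=; lra.
suff : 0 <= q.[y] by rewrite !hornerE /=; lra.
have [yx|xy|->] := ltgtP y x; last by rewrite qx.
  have [c] := poly_mvt q yx; rewrite in_itv /= => /andP[yc cx].
  have [d] := poly_mvt q^`() cx; rewrite in_itv /= => /andP[cd dx].
  rewrite q'x qx => e1 e2.
  have d0 : 0 <= q^`()^`().[d] by apply: q''0; apply/andP; split; lra.
  have : 0 <= q^`()^`().[d] * (x - c) by rewrite mulr_ge0 // subr_ge0 ltW.
  rewrite -e1 sub0r oppr_ge0 => c0.
  have : q^`().[c] * (x - y) <= 0 by rewrite mulr_le0_ge0 // subr_ge0 ltW.
  by rewrite -e2; lra.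
have [c] := poly_mvt q xy; rewrite in_itv /= => /andP[xc cy].
have [d] := poly_mvt q^`() xc; rewrite in_itv /= => /andP[xd dc].
rewrite q'x qx !subr0 => e1 ->.
have d0 : 0 <= q^`()^`().[d] by apply: q''0; apply/andP; split; lra.
rewrite e1 !mulr_ge0 // subr_ge0; lra.
Qed.

End BernsteinBounds.

Definition cell_dev (R : realType) (n m a : nat) : R := `|a%:R / m%:R - n%:R^-1|.

Lemma mu_bern (R : realType) n m (p : {ffun 'I_n -> R}) : is_distr p ->
  mu m p = 2^-1 * \sum_i (bern (@cell_dev R n m) m).[p i].
Proof.
move=> p_distr; rewrite /mu.
transitivity (E_iid p (fun x : sample n m => tv_seq R m (codom x))).
  by apply: eq_bigr => x _; rewrite tv_stat_codom.
rewrite E_iid_Eseq EseqZ Eseq_sum; congr (_ * _).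
by apply: eq_bigr => i _; rewrite -Eseq_count.
Qed.

Section Gap.
Variable R : realType.

Lemma dif2_cell_dev_ge0 n m a : 0 <= dif (dif (@cell_dev R n m)) a.
Proof.
rewrite /dif /cell_dev -![a.+2%:R]natr1 -![a.+1%:R]natr1 !mulrDl !mul1r.
move: (n%:R^-1) (m%:R^-1) (a%:R / m%:R) => c w u.
have := ler_normD (u + w + w - c) (u - c).
rewrite (_ : u + w + w - c + (u - c) = 2 * (u + w - c)); last by ring.
rewrite normrM ger0_norm //; lra.
Qed.

(** The kink [1 / n] lies between the points 0 and [1 / m], so the second difference at 0 picks it
    up. *)
Lemma dif2_cell_dev0 n m : (0 < m)%N -> (m <= n)%N ->
  2 * n%:R^-1 <= dif (dif (@cell_dev R n m)) 0.
Proof.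
move=> m0 mn; have n0 := leq_trans m0 mn.
have : n%:R^-1 <= m%:R^-1 :> R by rewrite lef_pV2 ?posrE ?ltr0n // ler_nat.
rewrite /dif /cell_dev mul0r mul1r mulr_natl sub0r normrN.
have : 0 < n%:R^-1 :> R by rewrite invr_gt0 ltr0n.
move: (n%:R^-1) (m%:R^-1) => c w c0 cw.
by rewrite mulr2n !ger0_norm; lra.
Qed.

(** Take [a + 1] to be the integer nearest to [kappa = m / n]: in units of [1 / m] the second
    difference is [2 - 2 * |a + 1 - kappa| >= 1]. *)
Lemma dif2_cell_dev_near n m : (0 < n)%N -> (n <= m)%N ->
  exists a, [/\ a%:R <= m%:R / n%:R :> R, m%:R / n%:R <= a%:R + 2 :> R
    & m%:R^-1 <= dif (dif (@cell_dev R n m)) a].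
Proof.
move=> n0 nm; have m0 := leq_trans n0 nm.
have n0' : 0 < n%:R :> R by rewrite ltr0n.
have m0' : 0 < m%:R :> R by rewrite ltr0n.
pose c := (m %/ n)%N.
have c0 : (0 < c)%N by rewrite divn_gt0.
have cle : c%:R <= m%:R / n%:R :> R.
  by rewrite ler_pdivlMr // -natrM ler_nat leq_divM.
have clt : m%:R / n%:R < c%:R + 1 :> R.
  by rewrite ltr_pdivrMr // natr1 -natrM ltr_nat ltn_ceil.
have E (a : nat) : cell_dev R n m a = m%:R^-1 * `|a%:R - m%:R / n%:R|.
  rewrite /cell_dev -[m%:R^-1 in RHS]gtr0_norm ?invr_gt0 // -normrM; congr (`|_|).
  by field; rewrite !gt_eqF.
have w0 : 0 < m%:R^-1 :> R by rewrite invr_gt0.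
have [k1|k1] := leP (m%:R / n%:R) (c%:R + 2^-1 : R).
  exists c.-1; rewrite -(prednK c0) -natr1 in cle clt k1.
  move: cle clt k1; rewrite /dif !E -[c.-1.+2%:R]natr1 -[c.-1.+1%:R]natr1.
  move: (m%:R / n%:R) (c.-1%:R) (m%:R^-1) w0 => k b w w0 h1 h2 h3.
  split; [lra|lra|].
  rewrite (@ger0_norm _ (b + 1 + 1 - k)) ?(@ler0_norm _ (b + 1 - k))
    ?(@ler0_norm _ (b - k)); try lra.
  by nra.
exists c; move: cle clt k1; rewrite /dif !E -[c.+2%:R]natr1 -[c.+1%:R]natr1.
move: (m%:R / n%:R) (c%:R) (m%:R^-1) w0 => k b w w0 h1 h2 h3.
split; [lra|lra|].
rewrite (@ger0_norm _ (b + 1 + 1 - k)) ?(@ger0_norm _ (b + 1 - k))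
  ?(@ler0_norm _ (b - k)); try lra.
by nra.
Qed.

Lemma uniform_distr n : (0 < n)%N -> is_distr (uniform R n).
Proof.
move=> n0; split=> [i|]; first by rewrite ffunE invr_ge0.
under eq_bigr do rewrite ffunE.
by rewrite sumr_const card_ord -[_ *+ _]mulr_natr mulVf // pnatr_eq0 -lt0n.
Qed.

(** Taylor at [1 / n] in every cell; the linear terms cancel because [q] and the uniform
    distribution have equal mass. Two uses of [deriv_bern] give the second derivative, of which only
    the binomial term at [a] is kept. *)
Lemma mu_gap_second_order n M (q : {ffun 'I_n -> R}) a lo hi c :
    (0 < n)%N -> is_distr q -> 0 <= lo -> hi <= 1 -> lo <= n%:R^-1 <= hi ->
    (forall i, lo <= q i <= hi) ->
    (forall x, lo <= x <= hi -> c <= pmf M a x) ->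
  2^-1 * (M.+1%:R * M.+2%:R * (dif (dif (@cell_dev R n M.+2)) a * c) / 2
    * \sum_i (q i - n%:R^-1) ^+ 2) <= mu M.+2 q - mu M.+2 (uniform R n).
Proof.
move=> n0 q_distr lo0 hi1 lohi qlohi pmfc.
rewrite !mu_bern //; last exact: uniform_distr.
rewrite -mulrBr ler_wpM2l ?invr_ge0 //.
set f := bern _ _; set D := dif (dif _); set B := M.+1%:R * _ * _.
have fB z : lo <= z <= hi -> B <= f^`()^`().[z].
  move=> zlh; have /andP[lz zh] := zlh.
  rewrite /f deriv_bern derivMn deriv_bern !hornerMn -mulrnA -mulr_natl natrM.
  rewrite /B -/D ler_wpM2l ?mulr_ge0 ?ler0n //.
  apply: (@le_trans _ _ (D a * pmf M a z)).
    by rewrite ler_wpM2l ?pmfc ?dif2_cell_dev_ge0.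
  apply: pmf_bern; first by move=> b; apply: dif2_cell_dev_ge0.
  by rewrite (le_trans lo0 lz) (le_trans zh hi1).
have t i := poly_taylor2_ge fB lohi (qlohi i).
have : \sum_i (f.[n%:R^-1] + f^`().[n%:R^-1] * (q i - n%:R^-1)
    + B / 2 * (q i - n%:R^-1) ^+ 2) <= \sum_i f.[q i].
  by apply: ler_sum => i _; apply: t.
rewrite !big_split /= -!mulr_sumr sumrB.
have -> : \sum_(i < n) f.[uniform R n i] = \sum_(i < n) f.[n%:R^-1].
  by apply: eq_bigr => i _; rewrite ffunE.
have S1 : \sum_(i < n) n%:R^-1 = 1 :> R.
  rewrite -[RHS](uniform_distr n0).2.
  by apply: eq_bigr => i _; rewrite ffunE.
rewrite q_distr.2 S1.
by rewrite subrr mulr0 addr0; lra.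
Qed.

End Gap.

Section TwoLevelGap.
Variables (R : realType) (n : nat) (T : {set 'I_n}) (eps : R).
Hypothesis (n2 : (2 <= n)%N) (Tn : #|T| = n./2) (eps01 : 0 < eps < 1).
(** As [T] has between [n / 3] and [n / 2] cells, it can carry an excess of [eps / 3], and [eps / 6]
    moves each cell by at most [eps / (2 * n)]. *)
Let q := two_level T (eps / 6).

Lemma half_cardsP : [/\ (0 < #|T|)%N, (0 < #|~: T|)%N,
  2 * #|T|%:R <= n%:R :> R, n%:R <= 3 * #|T|%:R :> R
  & #|~: T|%:R = n%:R - #|T|%:R :> R].
Proof.
have nE := odd_double_half n.
have h0 : (0 < n./2)%N by rewrite half_gt0.
have h2 : (n./2 * 2 <= n)%N by rewrite muln2 -[leqRHS]nE leq_addl.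
have cE : #|~: T| = (n - n./2)%N by rewrite cardsCs setCK card_ord Tn.
have hn : (n./2 < n)%N by apply: leq_trans h2; rewrite muln2 -addnn -addn1 leq_add2l.
split; rewrite ?Tn ?cE ?subn_gt0 //.
- by rewrite mulrC -natrM ler_nat.
- rewrite -natrM ler_nat -{1}nE -muln2 mulnC mulSn leq_add //.
  by case: odd.
by rewrite natrB // ltnW.
Qed.

Lemma two_level_near i : `|q i - n%:R^-1| <= eps / 2 * n%:R^-1.
Proof.
have [T0 Tc0 h2 h3 cE] := half_cardsP; case/andP: eps01 => e0 e1.
have n0 : 0 < n%:R :> R by rewrite ltr0n ltnW.
have T0' : 0 < #|T|%:R :> R by rewrite ltr0n.
have Tc0' : 0 < #|~: T|%:R :> R by rewrite ltr0n.
rewrite /q two_levelE; case: ifP => _.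
  rewrite addrAC subrr add0r ger0_norm; last by rewrite !divr_ge0 // ltW.
  rewrite -[eps / 2 * _]/(_ / _) ler_pdivlMr // mulrAC ler_pdivrMr //; nra.
rewrite addrAC subrr add0r normrN ger0_norm; last by rewrite !divr_ge0 // ltW.
rewrite -[eps / 2 * _]/(_ / _) ler_pdivlMr // mulrAC ler_pdivrMr //; nra.
Qed.

Lemma two_level_range i : 2^-1 * n%:R^-1 <= q i <= 3 / 2 * n%:R^-1.
Proof.
have := two_level_near i; case/andP: eps01 => e0 e1.
have n0 : 0 < n%:R^-1 :> R by rewrite invr_gt0 ltr0n ltnW.
rewrite ler_norml => /andP[h1 h2]; apply/andP; split; nra.
Qed.

Lemma two_level_distr : is_distr q.
Proof.
have [T0 Tc0 _ _ _] := half_cardsP.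
split; last exact: sum_two_level.
move=> i; case/andP: (two_level_range i) => h _; apply: le_trans h.
by rewrite mulr_ge0 ?invr_ge0.
Qed.

Lemma two_level_sqr : eps ^+ 2 / 18 * n%:R^-1 <= \sum_i (q i - n%:R^-1) ^+ 2.
Proof.
have [T0 Tc0 h2 h3 cE] := half_cardsP; case/andP: eps01 => e0 e1.
have n0 : 0 < n%:R :> R by rewrite ltr0n ltnW.
have T0' : 0 < #|T|%:R :> R by rewrite ltr0n.
apply: (@le_trans _ _ (\sum_(i in T) (eps / 6 / #|T|%:R) ^+ 2)).
  rewrite sumr_const -[_ *+ #|T|]mulr_natr ler_pdivrMr //.
  have -> : (eps / 6 / #|T|%:R) ^+ 2 * #|T|%:R = eps ^+ 2 / 36 / #|T|%:R.
    by field; rewrite gt_eqF.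
  rewrite [leRHS]mulrAC ler_pdivlMr //; have : 0 <= eps ^+ 2 by apply: sqr_ge0.
  nra.
rewrite [leRHS](bigID (mem T)) /=; apply: ler_wpDr.
  by apply: sumr_ge0 => i _; apply: sqr_ge0.
apply: ler_sum => i iT; rewrite /q two_levelE iT.
by rewrite addrAC subrr add0r.
Qed.

(* In the range n < m <= n / eps^2 the exponent in [pmf_ge] is at most 400 and
   e * sqrt (a + 1) <= 2 e * sqrt (m / n). *)
Definition pmf_const : R := expR (- 401) / 2.

Lemma pmf_const_gt0 : 0 < pmf_const.
Proof. by rewrite divr_gt0 ?expR_gt0. Qed.

Lemma mu_two_level_gap_sublinear M : (2 <= M)%N -> (M.+2 <= n)%N ->
  pmf_const / 144 * gap n M.+2 eps <= mu M.+2 q - mu M.+2 (uniform R n).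
Proof.
move=> M2 mn; case/andP: eps01 => e0 e1.
have n0 : (0 < n)%N by apply: ltnW.
have n2' : 2 <= n%:R :> R by rewrite ler_nat.
have k0 : 0 < n%:R^-1 :> R by rewrite invr_gt0 ltr0n.
have nk : n%:R * n%:R^-1 = 1 :> R by rewrite mulfV // pnatr_eq0 -lt0n.
have k2 : n%:R^-1 <= 2^-1 :> R by rewrite lef_pV2 ?posrE ?ltr0n.
have M2' : 2 <= M%:R :> R by rewrite ler_nat.
have Mn : M%:R + 2 <= n%:R :> R by rewrite -natrD addn2 ler_nat.
apply: le_trans (mu_gap_second_order (a := 0) (lo := 2^-1 * n%:R^-1)
  (hi := 3 / 2 * n%:R^-1) (c := pmf_const) n0 two_level_distr _ _ _ two_level_range _).
- have D0 := dif2_cell_dev0 R (ltn0Sn M.+1) mn.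
  have P0 := pmf_const_gt0; have S0 := two_level_sqr.
  rewrite /gap mn -[M.+1%:R]natr1 -[M.+2%:R]natr1 -[M.+1%:R]natr1.
  move: D0 S0; set D := dif _ _; set S := \sum_i _ => D0 S0.
  have -> : (M%:R + 1 + 1) ^+ 2 / n%:R ^+ 2 = (M%:R + 2) ^+ 2 * n%:R^-1 ^+ 2 :> R.
    by rewrite exprVn; congr (_ ^+ 2 * _); ring.
  move: (n%:R^-1) (M%:R) M2' k0 D0 S0 pmf_const P0 => k b b2 kp D0 S0 P P0.
  have [P0' k0' b20 e0'] : [/\ 0 <= P, 0 <= k, 0 <= b + 2 & 0 <= eps] by split; lra.
  have h1 : (b + 2) ^+ 2 / 2 <= (b + 1) * (b + 1 + 1) by nra.
  have h2 : 2 * k * P <= D * P by rewrite ler_wpM2r.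
  have h3 : (b + 2) ^+ 2 / 2 * (2 * k * P) <= (b + 1) * (b + 1 + 1) * (D * P).
    by apply: ler_pM => //; rewrite !mulr_ge0 ?invr_ge0.
  have h4 : (b + 2) ^+ 2 / 2 * (2 * k * P) * (eps ^+ 2 / 18 * k)
      <= (b + 1) * (b + 1 + 1) * (D * P) * S.
    by apply: ler_pM => //; rewrite !mulr_ge0 ?invr_ge0.
  have h5 : 0 <= (b + 2) ^+ 2 * k ^+ 2 * P * eps ^+ 2.
    by rewrite !mulr_ge0.
  lra.
- by rewrite mulr_ge0 ?invr_ge0.
- lra.
- by apply/andP; split; lra.
move=> x /andP[x1 x2].
have x0 : 0 < x by lra.
have x34 : x <= 3 / 4 by lra.
have x01 : 0 < x < 1 by rewrite x0; lra.
apply: le_trans (pmf_ge (leq0n M) (ltnW M2) x01).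
rewrite sqrtr1 mulr1 sub0r sqrrN -expRN -expRD /pmf_const.
have -> : (M%:R * x) ^+ 2 / (M%:R * x * (1 - x)) = M%:R * x / (1 - x).
  by field; rewrite !gt_eqF //; lra.
(* From [M * x <= 3 / 2] and [1 - x >= 1 / 4]: with at most [n] draws a cell stays empty with
   constant probability. *)
have hX : M%:R * x / (1 - x) <= 6.
  rewrite ler_pdivrMr; last by lra.
  have : M%:R * x <= n%:R * (3 / 2 * n%:R^-1).
    by apply: ler_pM => //; lra.
  have -> : n%:R * (3 / 2 * n%:R^-1) = 3 / 2 * (n%:R * n%:R^-1) :> R by ring.
  by rewrite nk; lra.
apply: (@le_trans _ _ (expR (- 401))).
  by rewrite ler_pdivrMr // ler_peMr ?expR_ge0 //; lra.
by rewrite ler_expR; lra.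
Qed.

(** Since [K * eps ^ 2 <= 1], letting [x] range over [(1 +- eps / 2) / n] shifts [m * x] by at most
    [sqrt K / 2], within the order of a standard deviation. The mass at [a] therefore stays of order
    [1 / sqrt K] on the whole range. *)
Lemma mu_two_level_gap_superlinear M : (2 <= M)%N -> (n < M.+2)%N ->
    M.+2%:R <= n%:R / eps ^+ 2 ->
  pmf_const / 144 * gap n M.+2 eps <= mu M.+2 q - mu M.+2 (uniform R n).
Proof.
move=> M2 nm mne; case/andP: eps01 => e0 e1.
have n0 : (0 < n)%N by apply: ltnW.
have n2' : 2 <= n%:R :> R by rewrite ler_nat.
have k0 : 0 < n%:R^-1 :> R by rewrite invr_gt0 ltr0n.
have nk : n%:R * n%:R^-1 = 1 :> R by rewrite mulfV // pnatr_eq0 -lt0n.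
have k2 : n%:R^-1 <= 2^-1 :> R by rewrite lef_pV2 ?posrE ?ltr0n.
have M2' : 2 <= M%:R :> R by rewrite ler_nat.
have [a [aK Ka Da]] := dif2_cell_dev_near R n0 (ltnW nm).
have mE : M.+2%:R = M%:R + 2 :> R by rewrite -[RHS]natrD addn2.
set m : R := M.+2%:R in mne aK Ka Da mE *.
set K := m / n%:R in aK Ka *.
have K1 : 1 <= K by rewrite ler_pdivlMr ?mul1r ?ler_nat ?ltr0n // ltnW.
have Ke : K * eps ^+ 2 <= 1.
  rewrite /K mulrAC ler_pdivrMr ?ltr0n // mul1r.
  by rewrite -ler_pdivlMr // exprn_gt0.
have sK : 0 < Num.sqrt K by rewrite sqrtr_gt0; lra.
have sKK : Num.sqrt K * Num.sqrt K = K.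
  by rewrite -expr2 sqr_sqrtr //; lra.
apply: le_trans (mu_gap_second_order (a := a) (lo := (1 - eps / 2) * n%:R^-1)
  (hi := (1 + eps / 2) * n%:R^-1) (c := pmf_const / Num.sqrt K) n0 two_level_distr
  _ _ _ _ _).
- rewrite /gap leqNgt nm /= mne -/K.
  have P0 := pmf_const_gt0; have S0 := two_level_sqr.
  have m0 : 0 < m by rewrite ltr0n.
  rewrite -/m (_ : M.+1%:R = m - 1); last by rewrite -[m]natr1 addrK.
  move: Da S0; set D := dif _ _; set S := \sum_i _ => D0 S0.
  set c := pmf_const / Num.sqrt K.
  have c0 : 0 < c by rewrite divr_gt0.
  have [m0' c0' e0' i0'] : [/\ 0 <= m, 0 <= c, 0 <= eps & 0 <= m^-1].
    by split; rewrite ?invr_ge0; exact: ltW.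
  have mc0 : 0 <= m^-1 * c by rewrite mulr_ge0.
  have h2 : m^-1 * c <= D * c by rewrite ler_wpM2r.
  have h3 : m / 2 * m * (m^-1 * c) <= (m - 1) * m * (D * c).
    apply: ler_pM => //; first by rewrite !mulr_ge0 ?invr_ge0.
    by rewrite ler_wpM2r //; lra.
  have h4 : m / 2 * m * (m^-1 * c) * (eps ^+ 2 / 18 * n%:R^-1)
      <= (m - 1) * m * (D * c) * S.
    apply: ler_pM => //; last by rewrite !mulr_ge0 ?invr_ge0.
    by rewrite mulr_ge0 // !mulr_ge0 ?invr_ge0.
  have E : m / 2 * m * (m^-1 * c) * (eps ^+ 2 / 18 * n%:R^-1)
      = pmf_const / 36 * (eps ^+ 2 * Num.sqrt K).
    have -> : Num.sqrt K = K / Num.sqrt K by rewrite -{2}sKK mulfK // gt_eqF.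
    rewrite /c /K; field.
    by rewrite !gt_eqF ?ltr0n //; lra.
  rewrite E in h4; lra.
- by rewrite mulr_ge0 //; lra.
- nra.
- by apply/andP; split; nra.
- move=> i; have := two_level_near i; rewrite ler_norml => /andP[h1 h2].
  by apply/andP; split; lra.
move=> x /andP[x1 x2].
have xl : 2^-1 * n%:R^-1 <= x by nra.
have x0 : 0 < x by nra.
have x34 : x <= 3 / 4 by nra.
have x01 : 0 < x < 1 by rewrite x0; lra.
have aM : (a <= M)%N.
  rewrite -(ler_nat R); apply: le_trans aK _.
  apply: (@le_trans _ _ (m / 2)); last by lra.
  by rewrite /K ler_wpM2l ?ler0n.
apply: le_trans (pmf_ge aM (ltnW M2) x01).
have MK : K / 2 <= M%:R * n%:R^-1 by rewrite /K mE; nra.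
have Mx : K / 4 <= M%:R * x.
  apply: (@le_trans _ _ (M%:R * (2^-1 * n%:R^-1))); first by nra.
  by rewrite ler_wpM2l ?ler0n.
have den : K / 16 <= M%:R * x * (1 - x) by nra.
(* Here [u] is a rounding error, bounded by 2, and [v] is the drift of [x] away from [1 / n];
   together with [den] this gives the exponent 400. *)
have num : (a%:R - M%:R * x) ^+ 2 <= 25 * K.
  pose v := m * (n%:R^-1 - x); pose u := a%:R - K + 2 * x.
  have -> : a%:R - M%:R * x = u + v by rewrite /u /v /K mE; ring.
  have v2 : v ^+ 2 <= K / 4.
    have hv : `|v| <= K * (eps / 2).
      rewrite /v /K normrM (@ger0_norm _ m) ?ler0n // -mulrA ler_wpM2l ?ler0n //.
      rewrite ler_norml; apply/andP; split; lra.
    rewrite -(real_normK (num_real v)).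
    apply: (@le_trans _ _ ((K * (eps / 2)) ^+ 2)).
      by rewrite lerXn2r ?nnegrE ?normr_ge0 // mulr_ge0 //; lra.
    have -> : (K * (eps / 2)) ^+ 2 = K / 4 * (K * eps ^+ 2) by field.
    by rewrite -[leRHS]mulr1 ler_wpM2l //; lra.
  have u2 : u ^+ 2 <= 12.
    have hu : `|u| <= 2 by rewrite ler_norml /u; apply/andP; split; lra.
    rewrite -(real_normK (num_real u)); have := normr_ge0 u; nra.
  have : 0 <= (u - v) ^+ 2 by apply: sqr_ge0.
  rewrite (_ : (u + v) ^+ 2 = 2 * u ^+ 2 + 2 * v ^+ 2 - (u - v) ^+ 2); last by ring.
  lra.
have dp : 0 < M%:R * x * (1 - x) by lra.
have hX : (a%:R - M%:R * x) ^+ 2 / (M%:R * x * (1 - x)) <= 400.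
  rewrite ler_pdivrMr //; lra.
have sa : Num.sqrt a.+1%:R <= 2 * Num.sqrt K.
  rewrite -(ler_pXn2r (n := 2)) ?nnegrE ?sqrtr_ge0 //; last first.
    by rewrite mulr_ge0 ?sqrtr_ge0.
  rewrite exprMn !sqr_sqrtr ?ler0n //; last by lra.
  by rewrite -natr1; lra.
have sa0 : 0 < Num.sqrt a.+1%:R :> R by rewrite sqrtr_gt0.
rewrite /pmf_const invfM -expRN.
apply: (@le_trans _ _ (expR (- 1) * (2 * Num.sqrt K)^-1 * expR (- 400))).
  rewrite le_eqVlt; apply/orP; left; apply/eqP.
  have -> : - 401 = - 1 + - 400 :> R by ring.
  by rewrite expRD invfM; ring.
have i0 : 0 <= (2 * Num.sqrt K)^-1 by rewrite invr_ge0 mulr_ge0 ?sqrtr_ge0.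
apply: ler_pM; rewrite ?expR_ge0 //; first by rewrite mulr_ge0 ?expR_ge0.
  by rewrite ler_wpM2l ?expR_ge0 // lef_pV2 ?posrE // mulr_gt0.
by rewrite ler_expR lerN2.
Qed.

End TwoLevelGap.

(** * Tail bounds *)

Section Tails.
Variables (R : realType) (n m : nat) (p : {ffun 'I_n -> R}).
Hypothesis p_distr : is_distr p.
Implicit Types (A : pred (sample n m)) (f : sample n m -> R).

Lemma iid_weight_ge0 (x : sample n m) : 0 <= iid_weight p x.
Proof. by apply: prodr_ge0 => j _; apply: p_distr.1. Qed.

Lemma Pr_iidE A : Pr_iid p A = E_iid p (fun x => (A x)%:R).
Proof.
rewrite /Pr_iid big_mkcond; apply: eq_bigr => x _.
by case: (A x); rewrite (mulr1, mulr0).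
Qed.

Lemma Pr_iidC A : Pr_iid p A = 1 - Pr_iid p (fun x => ~~ A x).
Proof.
apply/eqP; rewrite eq_sym subr_eq eq_sym; apply/eqP.
have : E_iid p (fun _ : sample n m => 1) = 1.
  exact: etrans (E_iid_Eseq m p (fun=> 1)) (Eseq_cst p_distr m 1).
move=> <-; rewrite /E_iid (bigID A) /=.
by congr (_ + _); apply: eq_bigr => x _; rewrite mulr1.
Qed.

Lemma ler_Pr_iid A1 A2 : (forall x, A1 x -> A2 x) -> Pr_iid p A1 <= Pr_iid p A2.
Proof.
move=> A12; rewrite !Pr_iidE; apply: ler_sum => x _.
rewrite ler_wpM2l ?iid_weight_ge0 // ler_nat.
by case: (A1 x) (A12 x) => // ->.
Qed.

Lemma chernoff f (a l : R) : 0 <= l ->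
  Pr_iid p (fun x => a <= f x) <= expR (- (l * a)) * E_iid p (fun x => expR (l * f x)).
Proof.
move=> l0; rewrite Pr_iidE /E_iid mulr_sumr; apply: ler_sum => x _.
rewrite mulrCA ler_wpM2l ?iid_weight_ge0 // -expRD addrC -mulrBr.
case: (leP a (f x)) => /= [ax|_]; last exact: expR_ge0.
by rewrite -expR0 ler_expR mulr_ge0 // subr_ge0.
Qed.

(** Chernoff at the optimal [l = s / (2 * V)]; the upper bound on [s] keeps [l] in the range of the
    moment bound, and [- l] serves the lower tail. *)
Lemma subgaussian_tail f (mean L V s : R) : 0 < V -> 0 <= s <= 2 * V * L ->
    (forall l, `|l| <= L ->
       E_iid p (fun x => expR (l * (f x - mean))) <= expR (l ^+ 2 * V)) ->
  Pr_iid p (fun x => mean + s <= f x) <= expR (- (s ^+ 2 / (4 * V))) /\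
  Pr_iid p (fun x => f x <= mean - s) <= expR (- (s ^+ 2 / (4 * V))).
Proof.
move=> V0 /andP[s0 sL] mgf.
pose l := s / (2 * V).
have l0 : 0 <= l by rewrite divr_ge0 // mulr_ge0 // ltW.
have lL : l <= L by rewrite ler_pdivrMr ?mulr_gt0 // mulrC.
have lE : - (l * s) + l ^+ 2 * V = - (s ^+ 2 / (4 * V)).
  by rewrite /l; field; rewrite gt_eqF.
split.
  apply: le_trans (ler_Pr_iid (A2 := fun x => s <= f x - mean) _) _.
    by move=> x; rewrite lerBrDl.
  apply: le_trans (chernoff _ _ l0) _; rewrite -lE expRD ler_wpM2l ?expR_ge0 //.
  by apply: mgf; rewrite ger0_norm.
apply: le_trans (ler_Pr_iid (A2 := fun x => s <= - (f x - mean)) _) _.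
  by move=> x; lra.
apply: le_trans (chernoff _ _ l0) _; rewrite -lE expRD ler_wpM2l ?expR_ge0 //.
rewrite -[l ^+ 2]sqrrN; apply: le_trans (mgf (- l) _); last by rewrite normrN ger0_norm.
by apply: ler_sum => x _; rewrite mulrN mulNr.
Qed.

Lemma E_iid_tv_stat (F : R -> R) :
  E_iid p (fun x : sample n m => F (tv_stat R x))
    = Eseq p m (fun s => F (tv_seq R m s)).
Proof.
rewrite -(E_iid_Eseq m p (fun s => F (tv_seq R m s))).
by apply: eq_bigr => x _; rewrite tv_stat_codom.
Qed.

Lemma mu_Eseq : mu m p = Eseq p m (tv_seq R m).
Proof. exact: (E_iid_tv_stat id). Qed.

(** Replacing a draw changes at most two frequencies, each by [1 / m], and S carries a factor
    1/2. *)
Lemma tv_seq_bounded_differences i j (s1 s2 : seq 'I_n) :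
  tv_seq R m (s1 ++ i :: s2) - tv_seq R m (s1 ++ j :: s2) <= m%:R^-1.
Proof.
rewrite /tv_seq -mulrBr -sumrB.
have sum1 a : \sum_(k < n) (a == k)%:R = 1 :> R.
  by rewrite (bigD1 a) //= eqxx big1 ?addr0 // => k; rewrite eq_sym => /negPf ->.
have : \sum_(k < n) ((i == k)%:R + (j == k)%:R) * m%:R^-1 = 2 * m%:R^-1 :> R.
  by rewrite -mulr_suml big_split /= !sum1.
suff : \sum_(k < n) (`|(count_mem k (s1 ++ i :: s2))%:R / m%:R - n%:R^-1|
    - `|(count_mem k (s1 ++ j :: s2))%:R / m%:R - n%:R^-1|)
    <= \sum_(k < n) ((i == k)%:R + (j == k)%:R) * m%:R^-1 :> R.
  lra.
apply: ler_sum => k _; apply: le_trans (ler_norm _) _.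
apply: le_trans (ler_dist_dist _ _) _.
rewrite !count_cat /= !natrD.
set a := (count_mem k s1)%:R; set b := (count_mem k s2)%:R.
set u := (i == k)%:R; set v := (j == k)%:R; set w := m%:R^-1.
rewrite (_ : _ - _ = (u - v) * w); last by ring.
have w0 : 0 <= w by rewrite invr_ge0.
rewrite normrM (ger0_norm w0) ler_wpM2r //.
by apply: le_trans (ler_normB _ _) _; rewrite !ger0_norm // ler0n.
Qed.

Lemma mgf_tv_stat l : (0 < m)%N -> `|l| <= m%:R ->
  E_iid p (fun x : sample n m => expR (l * (tv_stat R x - mu m p)))
    <= expR (l ^+ 2 * (2 / m%:R)).
Proof.
move=> m0 lm; have m0' : 0 < m%:R :> R by rewrite ltr0n.
rewrite (E_iid_tv_stat (fun t => expR (l * (t - mu m p)))) mu_Eseq.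
apply: le_trans (mgf_bounded_differences p_distr (c := m%:R^-1) _ _ _) _.
- by rewrite invr_ge0.
- by rewrite ler_pdivrMr ?mul1r.
- by move=> i j s1 s2 _; apply: tv_seq_bounded_differences.
rewrite le_eqVlt; apply/orP; left; apply/eqP; congr expR.
by field; rewrite gt_eqF.
Qed.

(** A seen cell has frequency at least [1 / m >= 1 / n], so only empty cells deviate downwards. The
    signed deviations sum to 0, so S is the total downward deviation. *)
Lemma tv_seq_unseen (s : seq 'I_n) : (0 < m)%N -> (m <= n)%N -> size s = m ->
  tv_seq R m s = n%:R^-1 * unseen R s.
Proof.
move=> m0 mn sz; have n0 := leq_trans m0 mn.
have nm : n%:R^-1 <= m%:R^-1 :> R by rewrite lef_pV2 ?posrE ?ltr0n // ler_nat.
have n0' : 0 <= n%:R^-1 :> R by rewrite invr_ge0.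
have m0' : 0 <= m%:R^-1 :> R by rewrite invr_ge0.
have sum_count : \sum_(i < n) (count_mem i s)%:R = m%:R :> R.
  rewrite -natr_sum -sz; congr (_%:R); elim: (s) => [|a t IHt] /=.
    by rewrite big1.
  rewrite big_split /= IHt (bigD1 a) //= eqxx big1 ?addn0 // => k.
  by rewrite eq_sym => /negPf ->.
have E i : `|(count_mem i s)%:R / m%:R - n%:R^-1|
    = (count_mem i s)%:R / m%:R - n%:R^-1 + 2 * n%:R^-1 * (i \notin s)%:R :> R.
  rewrite -has_pred1 has_count -leqNgt leqn0.
  case: (count_mem i s) => [|k] /=.
    by rewrite mul0r sub0r normrN ger0_norm //; ring.
  rewrite mulr0 addr0 ger0_norm // subr_ge0; apply: le_trans nm _.
  by rewrite -[leLHS]mul1r ler_wpM2r // ler1n.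
rewrite /tv_seq (eq_bigr _ (fun i _ => E i)) big_split /= sumrB -mulr_suml sum_count.
rewrite mulfV ?pnatr_eq0 -?lt0n // sumr_const card_ord -[_ *+ n]mulr_natl.
rewrite mulfV ?pnatr_eq0 -?lt0n // subrr add0r -mulr_sumr -/(unseen R s).
by rewrite !mulrA mulVf ?mul1r // pnatr_eq0.
Qed.

Lemma eq_Eseq_size (f g : seq 'I_n -> R) :
  (forall s, size s = m -> f s = g s) -> Eseq p m f = Eseq p m g.
Proof.
by move=> fg; apply/le_anti/andP; split; apply: ler_Eseq => // s sz; rewrite fg.
Qed.

Lemma mgf_tv_stat_sublinear l : (0 < m)%N -> (m <= n)%N ->
    (forall i, p i <= 2 * n%:R^-1) -> `|l| <= n%:R ->
  E_iid p (fun x : sample n m => expR (l * (tv_stat R x - mu m p)))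
    <= expR (l ^+ 2 * (4 * m%:R ^+ 2 / n%:R ^+ 3)).
Proof.
move=> m0 mn p2 ln; have n0 := leq_trans m0 mn.
have n0' : 0 < n%:R :> R by rewrite ltr0n.
have muE : mu m p = n%:R^-1 * mean_unseen p [::] m.
  rewrite mu_Eseq -(Eseq_unseen p_distr) -EseqZ.
  by apply: eq_Eseq_size => s; apply: tv_seq_unseen.
rewrite (E_iid_tv_stat (fun t => expR (l * (t - mu m p)))).
rewrite (eq_Eseq_size (g := fun s =>
  expR (- (l * mu m p)) * expR (l / n%:R * unseen R ([::] ++ s)))); last first.
  by move=> s sz; rewrite tv_seq_unseen // -expRD /=; congr expR; ring.
rewrite EseqZ.
have mgf := mgf_unseen p_distr (B := 2 * n%:R^-1).
apply: le_trans (ler_wpM2l (expR_ge0 _) (mgf _ _ _ _ _ _)) _ => //.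
- by rewrite mulr_ge0 ?invr_ge0.
- by rewrite normrM normfV (ger0_norm (ltW n0')) ler_pdivrMr ?mul1r.
rewrite -expRD le_eqVlt; apply/orP; left; apply/eqP; congr expR.
by rewrite muE /= add0n; field; rewrite gt_eqF.
Qed.

End Tails.

(** * Means of S for large samples *)

Section LargeSamples.
Variable R : realType.

Lemma bern_quadratic m (a b c x : R) :
  (bern (fun k => a + b * k%:R + c * k%:R ^+ 2) m).[x]
    = a + b * (m%:R * x) + c * (m%:R * x * (1 - x) + (m%:R * x) ^+ 2).
Proof.
elim: m a b c => [|m IHm] a b c /=; first by rewrite hornerC; ring.
have -> : bern (fun k => a + b * k.+1%:R + c * k.+1%:R ^+ 2) m
    = bern (fun k => (a + b + c) + (b + 2 * c) * k%:R + c * k%:R ^+ 2) m.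
  by apply: eq_bern => k; rewrite -[k.+1%:R]natr1; ring.
by rewrite hornerD !hornerM hornerD hornerN hornerX hornerC !IHm -[m.+1%:R]natr1; ring.
Qed.

Lemma ler_bern (h1 h2 : nat -> R) m x : 0 <= x <= 1 ->
  (forall k, h1 k <= h2 k) -> (bern h1 m).[x] <= (bern h2 m).[x].
Proof.
move=> x01 h12; rewrite -subr_ge0 -hornerN -hornerD -bernB.
by apply: bern_ge0 => // k; rewrite subr_ge0.
Qed.

(** Jensen cell by cell: the absolute value dominates both signs of its argument, whose binomial
    means are exact. The term [0 * k ^ 2] casts these affine functions into the form of
    [bern_quadratic]. *)
Lemma dTV_le_mu n m (p : {ffun 'I_n -> R}) : (0 < m)%N -> is_distr p ->
  dTV p (uniform R n) <= mu m p.
Proof.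
move=> m0 p_distr; rewrite mu_bern // /dTV ler_wpM2l ?invr_ge0 //.
have m0' : m%:R != 0 :> R by rewrite pnatr_eq0 -lt0n.
apply: ler_sum => i _; rewrite ffunE.
have p01 : 0 <= p i <= 1 by rewrite p_distr.1 distr_le1.
have n0' : n%:R != 0 :> R.
  by rewrite pnatr_eq0 -lt0n; apply: leq_trans (ltn_ord i).
have E (e : R) :
    (bern (fun k => - e * n%:R^-1 + e * m%:R^-1 * k%:R + 0 * k%:R ^+ 2) m).[p i]
    = e * (p i - n%:R^-1).
  by rewrite bern_quadratic; field; rewrite m0' n0'.
rewrite ler_norml lerNl; apply/andP; split.
  rewrite -[leLHS]mulN1r -E; apply: ler_bern => // k; rewrite /cell_dev.
  by rewrite distrC; apply: le_trans (ler_norm _); lra.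
rewrite -[leLHS]mul1r -E; apply: ler_bern => // k; rewrite /cell_dev.
by apply: le_trans (ler_norm _); lra.
Qed.

(** The frequency of a cell has standard deviation at most [1 / sqrt (n * m) <= eps / n]. *)
Lemma mu_uniform_le n m (eps : R) : (0 < n)%N -> (0 < m)%N -> 0 < eps ->
  n%:R <= m%:R * eps ^+ 2 -> mu m (uniform R n) <= eps / 2.
Proof.
move=> n0 m0 e0 nm; rewrite mu_bern; last exact: uniform_distr.
have m0' : 0 < m%:R :> R by rewrite ltr0n.
have n0' : 0 < n%:R :> R by rewrite ltr0n.
rewrite mulrC ler_wpM2r ?invr_ge0 //.
have -> : eps = \sum_(i < n) (eps / n%:R).
  by rewrite sumr_const card_ord -[_ *+ n]mulr_natr divfK ?gt_eqF.
apply: ler_sum => i _; rewrite ffunE.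
set k : R := n%:R^-1; set w : R := m%:R^-1.
have k0 : 0 < k by rewrite invr_gt0.
have w0 : 0 < w by rewrite invr_gt0.
have k01 : 0 <= k <= 1.
  by rewrite ltW //= invf_le1 // ler1n.
(* |u| <= (s + u^2 / s) / 2 with s = eps / n, then the binomial variance. *)
pose s := eps * k; have s0 : 0 < s by rewrite mulr_gt0.
have s20 : 2 * s != 0 by rewrite gt_eqF // mulr_gt0.
apply: (@le_trans _ _ (bern (fun a => (s / 2 + k ^+ 2 / (2 * s))
    + (- (2 * k * w / (2 * s))) * a%:R + w ^+ 2 / (2 * s) * a%:R ^+ 2) m).[k]).
  apply: ler_bern => // a; rewrite /cell_dev -/k -/w.
  set u := a%:R * w - k.
  rewrite [leRHS](_ : _ = (s ^+ 2 + u ^+ 2) / (2 * s)); last first.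
    by rewrite /u; field; rewrite gt_eqF.
  rewrite ler_pdivlMr ?mulr_gt0 // -(real_normK (num_real u)).
  have : 0 <= (s - `|u|) ^+ 2 by apply: sqr_ge0.
  nra.
rewrite bern_quadratic.
have wm : w = m%:R^-1 by [].
rewrite [leLHS](_ : _ = s / 2 + w * k * (1 - k) / (2 * s)); last first.
  by rewrite wm; field; rewrite !gt_eqF.
have : w * k * (1 - k) / (2 * s) <= s / 2.
  rewrite ler_pdivrMr ?mulr_gt0 //.
  rewrite (_ : s / 2 * (2 * s) = s ^+ 2); last by field.
  have wk : w <= eps ^+ 2 * k.
    by rewrite /w /k ler_pdivlMr // mulrC ler_pdivrMr // mulrC.
  rewrite /s exprMn; have : w * k <= eps ^+ 2 * k * k by rewrite ler_wpM2r // ltW.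
  have : 0 <= w * k * k by rewrite !mulr_ge0 // ltW.
  lra.
rewrite /s -/k; lra.
Qed.

End LargeSamples.

(** * Concentration at the given sample size and analysis of the tester *)

Section Tester.
Variable R : realType.

Lemma expR_log_inv (delta : R) : 0 < delta -> expR (- log_inv delta) <= delta.
Proof.
move=> d0; rewrite -[leRHS](@lnK _ delta) // ler_expR lerNl /log_inv.
by rewrite le_max div1r lnV ?posrE // lexx orbT.
Qed.

(** The two summands of the sample bound, separated and freed of the root: the first serves
    [m <= n / eps ^ 2], the second larger [m]. *)
Lemma sample_bound_le n m (eps delta K : R) : 0 < eps -> 0 <= K ->
    K * sample_bound n eps delta <= m%:R ->
  [/\ 1 <= log_inv delta,
      K ^+ 2 * (n%:R * log_inv delta) <= (m%:R * eps ^+ 2) ^+ 2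
    & K * log_inv delta <= m%:R * eps ^+ 2].
Proof.
move=> e0 K0 hm; set l := log_inv delta.
have l1 : 1 <= l by rewrite /l /log_inv le_max lexx.
have nl0 : 0 <= n%:R * l by rewrite mulr_ge0 //; lra.
have e2 : 0 < eps ^+ 2 by rewrite exprn_gt0.
have h : K * (Num.sqrt (n%:R * l) + l) <= m%:R * eps ^+ 2.
  move: hm; rewrite /sample_bound -/l div1r mulrCA mulrC.
  by rewrite ler_pdivrMr.
have r0 : 0 <= K * Num.sqrt (n%:R * l) by rewrite mulr_ge0 ?sqrtr_ge0.
have Kl0 : 0 <= K * l by rewrite mulr_ge0 //; lra.
split=> //; last by move: h; rewrite mulrDr; lra.
rewrite -[n%:R * l](sqr_sqrtr nl0) -exprMn lerXn2r ?nnegrE //.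
  by rewrite mulr_ge0 // ltW.
by move: h; rewrite mulrDr; lra.
Qed.

Lemma tv_stat_concentration n m (eps delta C' : R) (p : {ffun 'I_n -> R}) :
    (0 < n)%N -> (0 < m)%N -> 0 < eps < 1 -> 0 < delta -> 0 < C' <= 1 ->
    16 / C' ^+ 2 * sample_bound n eps delta <= m%:R -> is_distr p ->
    ((m <= n)%N -> forall i, p i <= 2 * n%:R^-1) ->
  Pr_iid p (fun x : sample n m => mu m p + C' * gap n m eps <= tv_stat R x) <= delta
  /\ Pr_iid p (fun x : sample n m => tv_stat R x <= mu m p - C' * gap n m eps)
    <= delta.
Proof.
move=> n0 m0 /andP[e0 e1] d0 /andP[C0 C1] hm p_distr p2.
have K0 : 0 <= 16 / C' ^+ 2 by rewrite divr_ge0 ?sqr_ge0.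
have [l1 hr hl] := sample_bound_le e0 K0 hm.
set l := log_inv delta in l1 hr hl.
have n0' : 0 < n%:R :> R by rewrite ltr0n.
have m0' : 0 < m%:R :> R by rewrite ltr0n.
have C2 : 0 < C' ^+ 2 by rewrite exprn_gt0.
have C21 : C' ^+ 2 <= 1 by rewrite expr_le1 // ltW.
have e20 : 0 < eps ^+ 2 by rewrite exprn_gt0.
have e21 : eps ^+ 2 <= 1 by rewrite expr_le1 // ltW.
have hl' : 16 * l <= C' ^+ 2 * (m%:R * eps ^+ 2).
  by move: hl; rewrite mulrAC ler_pdivrMr // [_ * C' ^+ 2]mulrC.
have hr' : 16 * (n%:R * l) <= C' ^+ 2 * (m%:R * eps ^+ 2) ^+ 2.
  move: hr; rewrite expr_div_n mulrAC ler_pdivrMr ?exprn_gt0 // => hr.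
  set X := (m%:R * eps ^+ 2) ^+ 2 in hr *.
  have X0 : 0 <= X by apply: sqr_ge0.
  have nl : 0 <= n%:R * l by rewrite mulr_ge0 //; lra.
  have : X * (C' ^+ 2) ^+ 2 <= X * C' ^+ 2.
    by rewrite ler_wpM2l // expr2 ler_piMr // ltW.
  lra.
have dE : expR (- l) <= delta by apply: expR_log_inv.
(* Each regime only has to supply a variance proxy [V] and a range [L] for the moment bound. The
   constant 16 of the sample bound is the one required when [m <= n]; the other regimes need 8. *)
suff [V [L [V0 sL mgf sV]]] : exists V L : R,
    [/\ 0 < V, 0 <= C' * gap n m eps <= 2 * V * L,
      forall t, `|t| <= L -> E_iid p (fun x : sample n m =>
        expR (t * (tv_stat R x - mu m p))) <= expR (t ^+ 2 * V)
      & l <= (C' * gap n m eps) ^+ 2 / (4 * V)].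
  have sd : expR (- ((C' * gap n m eps) ^+ 2 / (4 * V))) <= delta.
    by apply: le_trans dE; rewrite ler_expR lerN2.
  have [t1 t2] := subgaussian_tail p_distr V0 sL mgf.
  by split; [apply: le_trans t1 sd | apply: le_trans t2 sd].
rewrite /gap; case: ifP => [mn|/negbT]; last rewrite -ltnNge => nm.
  exists (4 * m%:R ^+ 2 / n%:R ^+ 3), n%:R; split.
  - by rewrite divr_gt0 ?mulr_gt0 ?exprn_gt0.
  - rewrite !mulr_ge0 ?invr_ge0 ?ler0n ?sqr_ge0 ?(ltW C0) ?(ltW e0) //=.
    rewrite [leRHS](_ : _ = 8 * (m%:R ^+ 2 / n%:R ^+ 2)); last first.
      by field; rewrite gt_eqF.
    rewrite mulrA ler_wpM2r ?divr_ge0 ?sqr_ge0 //.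
    have : C' * eps ^+ 2 <= 1 * 1 by apply: ler_pM => //; rewrite ?sqr_ge0 ?(ltW C0).
    lra.
  - by move=> t tL; apply: mgf_tv_stat_sublinear => //; apply: p2.
  rewrite [leRHS](_ : _ = C' ^+ 2 * (m%:R * eps ^+ 2) ^+ 2 / (16 * n%:R)).
    by rewrite ler_pdivlMr ?mulr_gt0 // mulrC -mulrA.
  by field; rewrite !gt_eqF.
have [mgfL LV] : (forall t, `|t| <= m%:R -> E_iid p (fun x : sample n m =>
      expR (t * (tv_stat R x - mu m p))) <= expR (t ^+ 2 * (2 / m%:R)))
    /\ 2 * (2 / m%:R) * m%:R = 4 :> R.
  split; first by move=> t tL; apply: mgf_tv_stat.
  by field; rewrite gt_eqF.
case: ifP => [mne|_].
  have Ke : m%:R / n%:R * eps ^+ 2 <= 1.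
    by rewrite mulrAC ler_pdivrMr // mul1r -ler_pdivlMr.
  have K0' : 0 <= m%:R / n%:R :> R by rewrite divr_ge0.
  have sE : Num.sqrt (m%:R / n%:R) ^+ 2 = m%:R / n%:R :> R by rewrite sqr_sqrtr.
  exists (2 / m%:R), m%:R; split => //.
  - by rewrite divr_gt0.
  - rewrite LV !mulr_ge0 ?sqrtr_ge0 ?(ltW C0) ?(ltW e0) //=.
    have : eps ^+ 2 * Num.sqrt (m%:R / n%:R) <= 1.
      rewrite -(expr_le1 (n := 2)) // ?mulr_ge0 ?sqrtr_ge0 ?(ltW e0) //.
      rewrite exprMn sE; nra.
    have : 0 <= eps ^+ 2 * Num.sqrt (m%:R / n%:R).
      by rewrite mulr_ge0 ?sqrtr_ge0 // ltW.
    nra.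
  rewrite exprMn exprMn sE.
  rewrite [leRHS](_ : _ = C' ^+ 2 * (m%:R * eps ^+ 2) ^+ 2 / (8 * n%:R)); last first.
    by field; rewrite !gt_eqF.
  rewrite ler_pdivlMr ?mulr_gt0 //.
  have : 0 <= n%:R * l by rewrite mulr_ge0 //; lra.
  lra.
exists (2 / m%:R), m%:R; split => //.
- by rewrite divr_gt0.
- by rewrite LV mulr_ge0 /= ?ltW //; nra.
rewrite [leRHS](_ : _ = C' ^+ 2 * (m%:R * eps ^+ 2) / 8); last first.
  by field; rewrite !gt_eqF.
lra.
Qed.

Lemma tester_NO n m (C' eps : R) (x : sample n m) :
  is_NO (tester C' eps x) = (threshold n m C' eps <= tv_stat R x).
Proof. by rewrite /tester; case: ifP. Qed.

Lemma tester_YES n m (C' eps : R) (x : sample n m) :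
  is_YES (tester C' eps x) = ~~ (threshold n m C' eps <= tv_stat R x).
Proof. by rewrite /tester; case: ifP. Qed.

Lemma sub1_le_Pr_iid n m (p : {ffun 'I_n -> R}) (A : pred (sample n m)) (delta : R) :
  is_distr p -> Pr_iid p (fun x => ~~ A x) <= delta -> 1 - delta <= Pr_iid p A.
Proof. by move=> p_distr h; rewrite Pr_iidC // lerB. Qed.

End Tester.

Theorem theorem2p1 (R : realType) :
  exists C C' : R, [/\ 0 < C, 0 < C' &
    forall (n : nat) (eps delta : R),
      (2 <= n)%N -> 0 < eps < 1 -> 0 < delta < 1 ->
    forall m : nat, C * sample_bound n eps delta <= m%:R ->
    forall p : {ffun 'I_n -> R}, is_distr p ->
      (p = uniform R n ->
         1 - delta
           <= Pr_iid p (fun x : sample n m => is_YES (tester C' eps x))) /\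
      (eps <= dTV p (uniform R n) ->
         1 - delta
           <= Pr_iid p (fun x : sample n m => is_NO (tester C' eps x)))].
Proof.
have P0 := pmf_const_gt0 R.
have P1 : pmf_const R <= 1.
  rewrite /pmf_const ler_pdivrMr // mul1r; apply: (@le_trans _ _ 1); last by lra.
  by rewrite -[leRHS]expR0 ler_expR lerNl oppr0.
(* Half of the constant [pmf_const / 144] in the gap lemmas: the threshold lies [C' * gap] above the
   uniform mean and at least as far below the other one. *)
pose C' := pmf_const R / 288.
have C0 : 0 < C' by rewrite divr_gt0.
have C1 : C' <= 1 by rewrite /C'; lra.
exists (16 / C' ^+ 2), C'; split=> //; first by rewrite divr_gt0 ?exprn_gt0.
move=> n eps delta n2 eps01 /andP[d0 d1] m hm p p_distr.
have n0 : (0 < n)%N by apply: ltnW.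
have U_distr := uniform_distr R n0.
case/andP: (eps01) => e0 e1.
have C01 : 0 < C' <= 1 by rewrite C0.
have e2 : 0 < eps ^+ 2 <= 1 by rewrite exprn_gt0 // expr_le1 // ltW.
(* The convention [1 <= log_inv delta] forces [m >= 16]; [m >= 4] makes [M = m - 2] at least 2 in
   the gap lemmas. *)
have m4 : (4 <= m)%N.
  have K0 : 0 <= 16 / C' ^+ 2 by rewrite divr_ge0 ?sqr_ge0.
  have [l1 _ hl] := sample_bound_le e0 K0 hm.
  have : 16 <= 16 / C' ^+ 2.
    rewrite ler_pdivlMr ?exprn_gt0 // ler_piMr // expr_le1 // ltW //.
  rewrite -(ler_nat R); have : 0 <= m%:R :> R by [].
  case/andP: e2; nra.
have m0 : (0 < m)%N by apply: leq_trans m4.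
have [M mE] : exists M, m = M.+2 by case: (m) m4 => [|[|M]] // _; exists M.
have M2 : (2 <= M)%N by move: m4; rewrite mE.
have n0' : 0 < n%:R^-1 :> R by rewrite invr_gt0 ltr0n.
split=> [->|heps].
  apply: sub1_le_Pr_iid => //.
  have [h _] := tv_stat_concentration n0 m0 eps01 d0 C01 hm U_distr
    (fun _ i => ltac:(rewrite ffunE; lra)).
  by apply: le_trans h; apply: ler_Pr_iid => // x; rewrite tester_YES negbK.
apply: sub1_le_Pr_iid => //.
have lower q : is_distr q -> ((m <= n)%N -> forall i, q i <= 2 * n%:R^-1) ->
    2 * C' * gap n m eps <= mu m q - mu m (uniform R n) ->
    Pr_iid q (fun x : sample n m => tv_stat R x < threshold n m C' eps) <= delta.
  move=> q_distr q2 q_gap.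
  have [_ h] := tv_stat_concentration n0 m0 eps01 d0 C01 hm q_distr q2.
  apply: le_trans h; apply: ler_Pr_iid => // x; rewrite /threshold; lra.
apply: le_trans (ler_Pr_iid p_distr
  (A2 := fun x : sample n m => tv_stat R x < threshold n m C' eps) _) _.
  by move=> x; rewrite tester_NO -ltNge.
(* Very large samples are settled for [p] itself, with a difference of means of at least [eps / 2].
   Otherwise [p] may be far from uniform and is replaced by [q], which stays near [1 / n] in every
   cell. *)
have [small|large] := boolP ((m <= n)%N || (m%:R <= n%:R / eps ^+ 2)); last first.
  move: large; rewrite negb_or -ltnNge -ltNge => /andP[nm me].
  apply: lower => //; first by rewrite leqNgt nm.
  rewrite /gap leqNgt nm /= [m%:R <= _]leNgt me /=.
  have := dTV_le_mu m0 p_distr.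
  have := mu_uniform_le n0 m0 e0 (_ : n%:R <= m%:R * eps ^+ 2).
  rewrite -ler_pdivrMr; last by case/andP: e2.
  move=> /(_ (ltW me)); rewrite /C'; nra.
have h0 : (0 < n./2)%N by rewrite half_gt0.
have h2 : (n./2.*2 <= n)%N by rewrite -[leqRHS]odd_double_half leq_addl.
have [|T Tn hT] := @exists_heavy_set R n n./2 (fun i => p i - n%:R^-1) h0 h2.
  rewrite sumrB p_distr.2 -[X in X - _]U_distr.2; apply/eqP; rewrite subr_eq0; apply/eqP.
  by apply: eq_bigr => i _; rewrite ffunE.
have [T0 Tc0 Th2 Th3 _] := half_cardsP R n2 Tn.
pose q := two_level T (eps / 6).
have q_distr : is_distr q by apply: two_level_distr.
have heavy : 0 <= eps / 6 <= \sum_(i in T) (p i - n%:R^-1).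
  rewrite divr_ge0 ?(ltW e0) //=.
  have hS : n./2%:R * eps <= n%:R * \sum_(i in T) (p i - n%:R^-1).
    apply: le_trans hT; rewrite ler_wpM2l //; apply: le_trans heps _.
    rewrite /dTV le_eqVlt; apply/orP; left; apply/eqP; congr (_ * _).
    by apply: eq_bigr => i _; rewrite ffunE.
  have n1 : 0 < n%:R :> R by rewrite ltr0n.
  rewrite -(ler_pM2l n1); apply: le_trans hS; rewrite -Tn; nra.
apply: (@le_trans _ _ (Pr_iid q
    (fun x : sample n m => tv_stat R x < threshold n m C' eps))).
  rewrite !Pr_iidE.
  pose g (t : R) : R := (t < threshold n m C' eps)%R%:R.
  have g_noninc (a b : R) : a <= b -> g b <= g a.
    move=> ab; rewrite /g ler_nat; case: (ltP b) => //= hb.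
    by rewrite (le_lt_trans ab hb).
  exact: (E_iid_two_level m g_noninc T0 Tc0 p_distr heavy).
apply: lower => //.
  move=> _ i; have /andP[_ h] := two_level_range n2 Tn eps01 i.
  by apply: le_trans h _; lra.
rewrite (_ : 2 * C' = pmf_const R / 144); last by rewrite /C'; field.
rewrite mE; rewrite mE in small.
have [mn|nm] := leqP M.+2 n; first exact: mu_two_level_gap_sublinear.
move: small; rewrite leqNgt nm /= => small.
exact: mu_two_level_gap_superlinear.
Qed.
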